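(* Let $\delta>0$ and suppose $\lim_kr_k=r\in[0,1]$. (a) If $r<1$, then $(\log n)^{-1/2}\big(N_n-\theta(m(n))\big)\xrightarrow{D}N(0,\sigma_r^2)$, where $\sigma_0^2=1$ and, for $r\ne0$, $\sigma_r^2=-r(1-r)^\delta\big((1-r)^{\delta+1}-(1+2\delta r)(1-r)^\delta+1\big)/\log(1-r)$. (b) If $r=1$, define $e_k=(1-r_k)(1-r_{k+1})\cdots(1-r_{k+\delta-1})$. If $\sum_{k=0}^\infty e_k=\infty$, then $$\frac{N_n-\theta(m(n))}{\sqrt{\sum_{k=0}^{m(n)}e_k}}\xrightarrow{D}N(0,1),$$ and if $\sum_{k=0}^\infty e_k<\infty$, then $\lim_nN_n<\infty$ almost surely.
   Context: Let $\{X_n,n\ge1\}$ be independent, identically distributed random variables with values in $\mathbb{Z}_+=\{0,1,2,\dots\}$ such that $p_k=P[X_1=k]>0$ for every $k\in\mathbb{Z}_+$ (set $p_m=0$ for integers $m\le -1$). For $k\in\mathbb{Z}_+$ let $y_k=\sum_{i>k}p_i$, and set $y_m=1$ for integers $m\le-1$. Let $r_k=p_k/y_{k-1}$, $k\in\mathbb{Z}_+$, and $m(t)=\min\{j\in\mathbb{Z}_+: y_j<1/t\}$ for $t>0$. For the fixed integer $\delta$ define $s_k=p_{k+\delta}/y_{k-1}$ and $\theta(k)=\sum_{i=0}^k s_i$ for $k\in\mathbb{Z}_+$. Let $M_0=0$ and $M_n=\max\{X_1,\dots,X_n\}$ for $n\ge1$, and let $N_n=\sum_{k=1}^n\mathbf{1}_{\{X_k>M_{k-1}+\delta\}}$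 be the number of $\delta$-records among the first $n$ observations. $N(0,\sigma^2)$ denotes the centered normal law with variance $\sigma^2$ and $\xrightarrow{D}$ convergence in distribution as $n\to\infty$. *)

(* Defs.v *)
From HB Require Import structures.
From mathcomp Require Import all_boot all_order all_algebra.
From mathcomp Require Import all_classical all_reals all_analysis.
From mathcomp Require Import normal_distribution.
Set Implicit Arguments. Unset Strict Implicit. Unset Printing Implicit Defensive.
Import Order.TTheory GRing.Theory Num.Theory.
Import numFieldNormedType.Exports.
Local Open Scope classical_set_scope.
Local Open Scope ring_scope.

Section delta_records.
Variable R : realType.

Definition ytail (p : nat -> R) (k : nat) : R :=
  limn (fun n => \sum_(k.+1 <= i < n) p i).

Definition yprev (p : nat -> R) (k : nat) : R :=
  if k is k'.+1 then ytail p k' else 1.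

Definition rseq (p : nat -> R) (k : nat) : R := p k / yprev p k.

Definition sseq (p : nat -> R) (delta k : nat) : R := p (k + delta)%N / yprev p k.

Definition theta (p : nat -> R) (delta k : nat) : R :=
  \sum_(i < k.+1) sseq p delta i.

(* m(t) = min { j : y_j < 1/t } (0 if no such j, which cannot happen here) *)
Definition mthr (p : nat -> R) (t : R) : nat :=
  match pselect (exists j, ytail p j < t^-1) with
  | left h => @ex_minn (fun j => ytail p j < t^-1) h
  | right _ => 0%N
  end.

Definition eseq (p : nat -> R) (delta k : nat) : R :=
  \prod_(k <= i < k + delta) (1 - rseq p i).

Definition sigma2 (delta : nat) (r : R) : R :=
  if r == 0 then 1
  else - r * (1 - r) ^+ delta
       * ((1 - r) ^+ delta.+1 - (1 + 2 * delta%:R * r) * (1 - r) ^+ delta + 1)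
       / ln (1 - r).

End delta_records.

Definition Mmax (T : Type) (X : nat -> T -> nat) (n : nat) (w : T) : nat :=
  \max_(1 <= i < n.+1) X i w.

Definition Nrec (T : Type) (X : nat -> T -> nat) (delta n : nat) (w : T) : nat :=
  \sum_(1 <= k < n.+1) (Mmax X k.-1 w + delta < X k w)%N.

(* convergence in distribution of real random variables Y_n to N(0, v),
   via distribution functions at every point (the limit cdf is continuous
   since v > 0 in all uses) *)
Definition cvg_dist_normal (d : measure_display) (T : measurableType d)
  (R : realType) (P : probability T R) (Y : nat -> T -> R) (v : R) : Prop :=
  forall x : R,
    (fun n => fine (P [set w | Y n w <= x])) @ \oo -->
      fine (normal_prob 0 (Num.sqrt v) [set z : R | z <= x]).

(* Main.v *)
Require Import Defs.
From HB Require Import structures.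
From mathcomp Require Import all_boot all_order all_algebra.
From mathcomp Require Import all_classical all_reals all_analysis.
From mathcomp Require Import measurable_realfun normal_distribution.
From mathcomp Require Import ring lra zify.
Set Implicit Arguments. Unset Strict Implicit. Unset Printing Implicit Defensive.
Import Order.TTheory GRing.Theory Num.Theory.
Import numFieldNormedType.Exports.
Local Open Scope classical_set_scope.
Local Open Scope ring_scope.

(* Call j a record value if some X_n = j exceeds all its predecessors. The events "j is a record
   value" are independent with probabilities r_j, and since delta > 0 a value j > delta is a
   delta-record exactly when j is a record value and none of j - delta, ..., j - 1 is. Hence N_n is
   the partial sum up to M_n of a delta-dependent 0-1 sequence whose means are q_j = s_(j - delta).
   - CLT for the sum up to m(n): Stein's method for locally dependent summands, with the Stein
     equation s^2 f' - x f = s^2 (h - c) solved for piecewise linear h.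
   - Variance: distinct delta-records at distance <= delta exclude each other, so the variance is
     the sum of q_i (1 - sum_(|j - i| <= delta) q_j); it is compared termwise with - ln (1 - r_j),
     which sums to - ln y ~ ln n, when r < 1, and with e_(j - delta) when r = 1.
   - Random index: with high probability M_n lies in [m(n/c), m(cn)], where the expected number of
     records is at most 1 + 2 ln c, uniformly in n.
   - If the e_k are summable, so are the q_j, and Borel-Cantelli applies. *)

(** * The Stein equation of the centered normal law *)

Section gauss.
Variable R : realType.
Implicit Types (x y s : R).

(** Sums over values below a fixed level involve finitely many independent indicators, so their
    moments come from the finite recursion [Ex], free of measurability; [pr_record_law] is the
    bridge to [P]. Stein's method then asks for a scale B tending to infinity, a variance equivalent
    to s^2 B^2 and a mean O(B^2): apart from the variance defect the error is O(1 / B). The two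
    regimes differ in the scale. From y_m(n) < 1 / n <= y_(m(n) - 1), the sum of the hazards - ln (1
    - r_j) up to m(n) matches ln n within its last term, which is bounded when r < 1 but not when r
    = 1. In that case q_j is equivalent to e_(j - delta) and the neighbouring q_j tend to 0, so the
    sum of the e_k takes over. M_n depends on the records that it cuts off. But the number of
    delta-record values below a level is monotone in the level, so for M_n in the window both counts
    are caught between those at the two ends, and Markov's inequality suffices. Levels strictly
    inside the window contribute at most ln (c / n) + ln (c n) = 2 ln c to the mean; at the top
    level, where y may drop by any factor, only q <= 1 is available. *)

Definition ramp (a e x : R) : R := Num.max 0 (Num.min 1 ((a + e - x) / e)).

Lemma ramp_itv (a e x : R) : 0 <= ramp a e x <= 1.
Proof. by rewrite /ramp le_max lexx ge_max ler01 ge_min lexx. Qed.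

Lemma ramp_le (a e x : R) : 0 < e -> x <= a -> ramp a e x = 1.
Proof.
move=> e0 xa; have h : 1 <= (a + e - x) / e by rewrite ler_pdivlMr//; lra.
by rewrite /ramp (min_idPl h) (max_idPr ler01).
Qed.

Lemma ramp_ge (a e x : R) : 0 < e -> a + e <= x -> ramp a e x = 0.
Proof.
move=> e0 xa; have h : (a + e - x) / e <= 0 by rewrite ler_pdivrMr// mul0r; lra.
by rewrite /ramp (min_idPr (le_trans h ler01)) (max_idPl h).
Qed.

(** The finite slope 1 / e is what makes the derivative of the Stein solution locally Lipschitz; for
    the indicators that the ramp brackets, this derivative would jump. *)
Lemma ramp_lip (a e x y : R) : 0 < e -> `|ramp a e x - ramp a e y| <= `|x - y| / e.
Proof.
move=> e0.
have -> : `|x - y| / e = `|(a + e - x) / e - (a + e - y) / e|.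
  by rewrite -mulrBl normrM (gtr0_norm (x := e^-1)) ?invr_gt0// distrC; congr (`|_| * _); ring.
rewrite /ramp; move: ((a + e - x) / e) ((a + e - y) / e) => u v.
have uv : u - v <= `|u - v| by exact: ler_norm.
have vu : v - u <= `|u - v| by rewrite distrC; exact: ler_norm.
rewrite ler_norml; case: (leP 1 u) => ?; case: (leP 1 v) => ?; rewrite ?(max_r ler01);
  (try case: (leP 0 u) => ?); (try case: (leP 0 v) => ?); lra.
Qed.

Lemma lip_continuous (f : R -> R) (C : R) : (forall x y, `|f x - f y| <= C * `|x - y|) ->
  continuous f.
Proof.
move=> fl x; apply/cvgrPdist_lt => e e0.
near=> y.
have C0 : 0 < `|C| + 1 by have := normr_ge0 C; lra.
have : `|x - y| < e / (`|C| + 1).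
  by near: y; apply/nbhs_ballP; exists (e / (`|C| + 1)) => //=; rewrite divr_gt0.
rewrite ltr_pdivlMr// => h; apply: le_lt_trans (fl x y) _; apply: le_lt_trans h.
rewrite mulrC ler_wpM2l//.
by have := ler_norm C; lra.
Unshelve. all: by end_near. Qed.

Lemma ramp_continuous (a e : R) : 0 < e -> continuous (ramp a e).
Proof.
move=> e0; apply: (@lip_continuous _ e^-1) => x y; rewrite mulrC; exact: ramp_lip.
Qed.

Lemma deriv_nonincr (f df : R -> R) (a b : R) : a <= b ->
  (forall x, is_derive x 1 f (df x)) ->
  (forall x, a <= x <= b -> df x <= 0) -> f b <= f a.
Proof.
move=> ab fd dle.
have fc : {within `[a, b], continuous f}.
  apply: continuous_subspaceT => x; apply: differentiable_continuous.
  by apply/derivable1_diffP; have [] := fd x.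
have [c + E] := @MVT_segment R f df a b ab (fun x _ => fd x) fc.
rewrite in_itv/= => /dle dc.
by rewrite -subr_le0 E mulr_le0_ge0 ?subr_ge0.
Qed.

Lemma deriv_lip (f df : R -> R) (a b C : R) :
  (forall x, is_derive x 1 f (df x)) ->
  (forall x, `|df x| <= C) -> `|f b - f a| <= C * `|b - a|.
Proof.
move=> fd dle.
wlog ab : a b / a <= b.
  move=> H; have [/H//|/ltW/H] := leP a b; by rewrite distrC (distrC a).
have fc : {within `[a, b], continuous f}.
  apply: continuous_subspaceT => x; apply: differentiable_continuous.
  by apply/derivable1_diffP; have [] := fd x.
have [c _ ->] := @MVT_segment R f df a b ab (fun x _ => fd x) fc.
by rewrite normrM ler_wpM2r.
Qed.

Section density.
Variable s : R.
Hypothesis s0 : 0 < s.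
Local Notation phi := (normal_pdf 0 s).
Local Notation mu := (@lebesgue_measure R).
Let sn0 : s != 0 := lt0r_neq0 s0.

Definition Phi (s x : R) : R := fine (normal_prob 0 s [set z : R | z <= x]).

Lemma Phi_Rintegral x : Phi s x = \int[mu]_(t in `]-oo, x]) phi t.
Proof. by rewrite /Phi set_itvE. Qed.

Lemma phi_gt0 x : 0 < phi x.
Proof. by rewrite normal_pdfE// mulr_gt0 ?normal_peak_gt0 ?expR_gt0. Qed.

Lemma phi_derive x : is_derive x 1 phi (- x / s ^+ 2 * phi x).
Proof.
rewrite normal_pdfE//.
pose g (y : R) := - (2 * s ^+ 2)^-1 * y ^+ 2.
have -> : (fun y => normal_peak s * normal_fun 0 s y) = (normal_peak s) \*: (expR \o g).
  apply/funext => y /=; rewrite /GRing.scale_fun /= /normal_fun /g subr0; congr (_ * expR _).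
  by field.
have gd : is_derive x 1 g (- x / s ^+ 2).
  rewrite /g; apply: is_derive_eq; rewrite /GRing.scale/=; field.
  by rewrite sn0.
apply: is_derive_eq => /=.
have -> : normal_fun 0 s x = expR (g x).
  by rewrite /normal_fun /g subr0; congr (expR _); field.
rewrite /GRing.scale/=; ring.
Qed.

Lemma phi_integrable (D : set R) : measurable D -> mu.-integrable D (EFin \o phi).
Proof.
move=> mD; apply: (@integrableS _ _ _ mu setT) => //.
exact: integrable_normal_pdf.
Qed.

End density.
End gauss.
Lemma Rintegral_split_at (R : realType) (f : R -> R) (x : R) : (@lebesgue_measure R).-integrable setT (EFin \o f) ->
  \int[@lebesgue_measure R]_t f t = \int[@lebesgue_measure R]_(t in `]-oo, x]) f t + \int[@lebesgue_measure R]_(t in `]x, +oo[) f t.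
Proof.
move=> fi.
have E : `]-oo, x] `|` `]x, +oo[ = [set: R].
  rewrite -subTset => t _; case: (leP t x) => tx; [left|right]; by rewrite /= in_itv/= ?tx.
rewrite -{1}E Rintegral_setU// ?E//.
rewrite disj_set2E; apply/eqP; rewrite -subset0 => t [] /=; rewrite !in_itv/= andbT.
by move=> /le_lt_trans/[apply]; rewrite ltxx.
Qed.

Section stein_solution.
Variables (R : realType) (s : R).
Implicit Types x y z t : R.
Hypothesis s0 : 0 < s.
Local Notation phi := (normal_pdf 0 s).
Local Notation mu := (@lebesgue_measure R).
Let sn0 : s != 0 := lt0r_neq0 s0.

Lemma Phi_itv (x : R) : Phi s x = fine (normal_prob 0 s `]-oo, x]).
Proof. by rewrite /Phi set_itvE. Qed.

Lemma Phi_near1 (e x : R) : 0 < e -> exists2 y, x <= y & 1 - Phi s y < e.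
Proof.
move=> e0.
pose A (n : nat) : set R := `]-oo, n%:R]%classic.
have : normal_prob 0 s (A n) @[n --> \oo] --> normal_prob 0 s (\bigcup_n A n).
  apply: nondecreasing_cvg_mu => //; first by move=> n; exact: measurable_itv.
    by apply: bigcup_measurable => n _; exact: measurable_itv.
  move=> n m nm; apply/subsetPset => z; rewrite /A/= !in_itv/= => /le_trans.
  by apply; rewrite ler_nat.
have -> : \bigcup_n A n = setT.
  rewrite -subTset => t _; exists (Num.truncn t).+1 => //=.
  by rewrite /A /= in_itv/= ltW// truncnS_gt.
rewrite probability_setT => /fine_cvg /cvgrPdist_lt /(_ _ e0)[N _ hN].
pose n := maxn N (Num.truncn x).+1.
have := hN n (leq_maxl _ _) => /= H.
exists n%:R.
  by rewrite (le_trans (ltW (truncnS_gt x)))// ler_nat leq_maxr.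
by apply: le_lt_trans H; rewrite Phi_itv ler_norm.
Qed.

Lemma Phi_near0 (e x : R) : 0 < e -> exists2 y, y <= x & Phi s y < e.
Proof.
move=> e0.
pose A (n : nat) : set R := `]-oo, - n%:R]%classic.
have : normal_prob 0 s (A n) @[n --> \oo] --> normal_prob 0 s (\bigcap_n A n).
  apply: nonincreasing_cvg_mu => //.
  - by apply: (le_lt_trans (probability_le1 _ _)); rewrite ?ltry//; exact: measurable_itv.
  - by move=> n; exact: measurable_itv.
  - by apply: bigcap_measurable => // n _; exact: measurable_itv.
  move=> n m nm; apply/subsetPset => z; rewrite /A/= !in_itv/= => /le_trans.
  by apply; rewrite lerN2 ler_nat.
have -> : \bigcap_n A n = set0.
  rewrite -subset0 => t /(_ (Num.truncn (- t)).+1 I); rewrite /A /= in_itv/=.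
  by rewrite leNgt ltrNl truncnS_gt.
rewrite measure0 => /fine_cvg /cvgrPdist_lt /(_ _ e0)[N _ hN].
pose n := maxn N (Num.truncn (- x)).+1.
have := hN n (leq_maxl _ _) => /= H.
exists (- n%:R).
  by rewrite lerNl (le_trans (ltW (truncnS_gt (- x))))// ler_nat leq_maxr.
by apply: le_lt_trans H; rewrite sub0r normrN Phi_itv ler_norm.
Qed.

Section rhs.
Variables (h : R -> R) (c : R).
Hypotheses (hc : continuous h) (h01 : forall x, 0 <= h x <= 1).
Hypothesis cE : c = \int[mu]_t (h t * phi t).

Lemma weighted_phi_integrable (D : set R) : measurable D -> mu.-integrable D (EFin \o (fun t => h t * phi t)).
Proof.
move=> mD; apply: (@integrableS _ _ _ mu setT) => //.
apply: (le_integrable _ _ _ (phi_integrable s measurableT)) => //.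
  apply/measurable_EFinP; apply: measurable_funM.
    exact: continuous_measurable_fun.
  exact: measurable_normal_pdf.
move=> x _ /=; rewrite lee_fin normrM ler_piMl//.
by have /andP[h0 h1] := h01 x; rewrite ger0_norm.
Qed.

Lemma stein_mean_itv : 0 <= c <= 1.
Proof.
rewrite cE; apply/andP; split.
  apply: Rintegral_ge0 => x _; rewrite mulr_ge0 ?normal_pdf_ge0//.
  by have /andP[] := h01 x.
have <- : \int[mu]_t phi t = 1 by rewrite /Rintegral integral_normal_pdf.
apply: le_Rintegral => //; first exact: weighted_phi_integrable.
  exact: phi_integrable.
move=> x _; rewrite ler_piMl ?normal_pdf_ge0//.
by have /andP[] := h01 x.
Qed.

Let g t := (h t - c) * phi t.

Let g_int (D : set R) : measurable D -> mu.-integrable D (EFin \o g).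
Proof.
move=> mD.
have := @integrableB _ _ _ mu D mD _ _ (weighted_phi_integrable mD) (@integrableZl _ _ _ mu D mD c _ (phi_integrable s mD)).
by apply: eq_integrable => // t _ /=; rewrite /g mulrBl.
Qed.

Let g_le t : `|g t| <= phi t.
Proof.
rewrite normrM (ger0_norm (normal_pdf_ge0 _ _ _)) ler_piMl ?normal_pdf_ge0//.
have /andP[? ?] := h01 t; have /andP[? ?] := stein_mean_itv.
by rewrite ler_norml; lra.
Qed.

Let F x := \int[mu]_(t in `]-oo, x]) g t.

Let F_le_Phi x : `|F x| <= Phi s x.
Proof.
rewrite /F Phi_Rintegral; apply: le_trans (le_normr_Rintegral _ _) _ => //.
  exact: g_int.
apply: le_Rintegral => //; last exact: phi_integrable.
have := g_int (measurable_itv `]-oo, x]); move/integrable_norm.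
by [].
Qed.

Let g_total : \int[mu]_t g t = 0.
Proof.
rewrite (_ : g = fun t => h t * phi t - c * phi t); last first.
  by apply/funext => t; rewrite /g mulrBl.
rewrite RintegralB//; [|exact: weighted_phi_integrable|]; last first.
  have := @integrableZl _ _ _ mu _ measurableT c _ (phi_integrable s measurableT).
  by [].
rewrite -cE RintegralZl//; last exact: phi_integrable.
have -> : \int[mu]_t phi t = 1 by rewrite /Rintegral integral_normal_pdf.
by rewrite mulr1 subrr.
Qed.

Let F_le_tail x : `|F x| <= 1 - Phi s x.
Proof.
have -> : 1 - Phi s x = \int[mu]_(t in `]x, +oo[) phi t.
  have : \int[mu]_t phi t = 1 by rewrite /Rintegral integral_normal_pdf.
  rewrite (Rintegral_split_at x) => [<-|]; last exact: phi_integrable.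
  by rewrite Phi_Rintegral addrC addKr.
have -> : F x = - \int[mu]_(t in `]x, +oo[) g t.
  have := g_total; rewrite (Rintegral_split_at x); last exact: g_int.
  by move/eqP; rewrite addr_eq0 => /eqP.
rewrite normrN; apply: le_trans (le_normr_Rintegral _ _) _ => //.
  exact: g_int.
apply: le_Rintegral => //; last exact: phi_integrable.
have := g_int (measurable_itv `]x, +oo[); move/integrable_norm.
by [].
Qed.

(** Fundamental theorem of calculus, the integrand being continuous because h is. Besides the Stein
    solution it serves [Phi] itself, the primitive for h = 1 and c = 0. *)
Lemma stein_primitive_derive x : is_derive x 1 F (g x).
Proof.
have xu : x < x + 1 by lra.
have gc : {for x, continuous g}.
  apply: cvgM; last exact: continuous_normal_pdf.
  by apply: cvgB; [exact: hc|exact: cvg_cst].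
have gi := g_int (measurable_itv `]-oo, (x+1)]).
have [] := continuous_FTC1 xu gi _ gc; first by rewrite ltNyr.
by move=> d E; apply: DeriveDef => //; rewrite -derive1E.
Qed.

(* Compare F with s^2 phi / x through the function s^2 phi(y) / x - F(y) of y, which is monotone beyond
   x and vanishes at infinity; both tails are needed, whence the condition c = E h. *)
Lemma mills_bound x : `|x * F x| <= s ^+ 2 * phi x.
Proof.
have pp := phi_gt0 s0 x.
have H (sg : R) : sg = 1 \/ sg = -1 -> (sg * (x * F x) <= s ^+ 2 * phi x).
  move=> sgE; have sg1 : `|sg| = 1 by case: sgE => ->; rewrite ?normrN normr1.
  have Gd y : is_derive y 1 ((s^+2 / x) \*: phi - sg \*: F) ((s^+2 / x) * (- y / s ^+ 2 * phi y) - sg * g y).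
    apply: is_deriveB; apply: is_deriveZ; [exact: phi_derive|exact: stein_primitive_derive].
  have sg_g y : - (sg * g y) <= phi y.
    by apply: le_trans (ler_norm _) _; rewrite normrN normrM sg1 mul1r g_le.
  have dle y : x != 0 -> 1 <= y / x -> (s^+2 / x) * (- y / s ^+ 2 * phi y) - sg * g y <= 0.
    move=> x0 yx; have -> : (s^+2 / x) * (- y / s ^+ 2 * phi y) = - (y / x * phi y).
      by field; rewrite ?x0 ?sn0.
    have := sg_g y; have : phi y <= y / x * phi y by rewrite ler_peMl ?normal_pdf_ge0.
    lra.
  have FB (y b : R) : `|F y| <= b -> sg * F y <= b.
    by move=> Fb; apply: le_trans (ler_norm _) _; rewrite normrM sg1 mul1r.
  have FB' (y b : R) : `|F y| <= b -> - b <= sg * F y.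
    by move=> Fb; rewrite lerNl; apply: le_trans (ler_norm _) _; rewrite normrN normrM sg1 mul1r.
  have [x0|x0|<-] := ltgtP 0 x; last first.
  - by rewrite mul0r mulr0 mulr_ge0 ?sqr_ge0 ?normal_pdf_ge0.
  - have : s ^+ 2 / x * phi x <= sg * F x.
      apply/ler_addgt0Pr => e e0.
      have [y yx Py] := Phi_near0 x e0.
      have dle' z : y <= z <= x -> s ^+ 2 / x * (- z / s ^+ 2 * phi z) - sg * g z <= 0.
        move=> /andP[yz zx]; apply: dle; first by rewrite lt_eqF.
        by rewrite ler_ndivlMr// mul1r.
      have /= := deriv_nonincr yx Gd dle'; rewrite !fctE/= /GRing.scale/=.
      have := FB' y _ (F_le_Phi y).
      have : s ^+ 2 / x * phi y <= 0.
        by rewrite mulr_le0_ge0 ?normal_pdf_ge0// mulr_ge0_le0 ?sqr_ge0// invr_le0 ltW.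
      lra.
    rewrite mulrAC ler_ndivrMr//; lra.
  - have : sg * F x <= s ^+ 2 / x * phi x.
      apply/ler_addgt0Pr => e e0.
      have [y yx Py] := Phi_near1 x e0.
      have dle' z : x <= z <= y -> s ^+ 2 / x * (- z / s ^+ 2 * phi z) - sg * g z <= 0.
        move=> /andP[yz zx]; apply: dle; first by rewrite gt_eqF.
        by rewrite ler_pdivlMr// mul1r.
      have /= := deriv_nonincr yx Gd dle'; rewrite !fctE/= /GRing.scale/=.
      have := FB y _ (F_le_tail y).
      have : 0 <= s ^+ 2 / x * phi y.
        by rewrite mulr_ge0 ?normal_pdf_ge0// mulr_ge0 ?sqr_ge0// invr_ge0 ltW.
      lra.
    rewrite mulrAC ler_pdivlMr//; lra.
rewrite ler_norml.
have := H 1 (or_introl erefl); have := H (-1) (or_intror erefl); lra.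
Qed.

End rhs.
End stein_solution.

Lemma normr_div (R : numFieldType) (x y : R) : 0 < y -> `|x / y| = `|x| / y.
Proof. by move=> y0; rewrite normrM normfV (gtr0_norm y0). Qed.

Section stein_equation.
Variables (R : realType) (s a e : R).
Implicit Types x y : R.
Hypotheses (s0 : 0 < s) (e0 : 0 < e).
Local Notation phi := (normal_pdf 0 s).
Local Notation mu := (@lebesgue_measure R).
Let sn0 : s != 0 := lt0r_neq0 s0.

Lemma phi_inv_derive (x : R) : is_derive x 1 (fun y => (phi y)^-1) (x / s ^+ 2 * (phi x)^-1).
Proof.
have pp := phi_gt0 s0; have pn x' : phi x' != 0 by rewrite gt_eqF ?pp.
have d := phi_derive s0 x.
apply: (is_derive_eq (is_deriveV (pn x) d)).
rewrite /GRing.scale/=; field.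
by rewrite sn0 pn.
Qed.

(** The solution is f = F / phi, with F the primitive of (h - c) phi vanishing at minus infinity.
    The bound on x F gives |x f| <= s^2, hence |f'| <= 2. For the variation of f' only a Lipschitz
    bound growing like 1 + |x| is extracted: it is elementary, and the growth is paid for later by a
    bound on E |W|. *)
Lemma stein_equation : exists f f' : R -> R, exists C c : R,
  [/\ 0 < C, Phi s a <= c <= Phi s (a + e),
      forall x, is_derive x 1 f (f' x),
      forall x, s ^+ 2 * f' x - x * f x = s ^+ 2 * (ramp a e x - c) &
      (forall x, `|f' x| <= C) /\
      (forall x y, `|f' x - f' y| <= C * (1 + `|x|) * `|x - y|)].
Proof.
pose h := ramp a e; pose c := \int[mu]_t (h t * phi t).
have hc : continuous h by exact: ramp_continuous.
have h01 := ramp_itv a e : forall x, 0 <= h x <= 1.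
have hint := weighted_phi_integrable s hc h01.
have pp := phi_gt0 s0.
have Fd := stein_primitive_derive s0 c hc h01.
have FB := mills_bound s0 hc h01 (erefl c).
have c01 : 0 <= c <= 1 := stein_mean_itv hc h01 (erefl c).
set F := (fun x => \int[mu]_(t in `]-oo, x]) ((h t - c) * phi t)) in Fd FB.
pose f x := F x / phi x.
pose f' x := (h x - c) + x / s ^+ 2 * f x.
have fd x : is_derive x 1 f (f' x).
  have -> : f = F * (fun y => (phi y)^-1) by [].
  have ? := phi_inv_derive x; have ? := Fd x; apply: is_derive_eq.
  rewrite /f' /f /GRing.scale/=; field.
  by rewrite sn0 gt_eqF ?pp.
have s2 : 0 < s ^+ 2 by rewrite exprn_gt0.
have eqn x : s ^+ 2 * f' x - x * f x = s ^+ 2 * (h x - c).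
  by rewrite /f'; field.
have xf x : `|x * f x| <= s ^+ 2.
  rewrite /f mulrA normr_div//.
  by rewrite ler_pdivrMr.
have f'2 x : `|f' x| <= 2.
  have -> : f' x = (h x - c) + (x * f x) / s ^+ 2 by rewrite /f'; ring.
  have : `|(x * f x) / s ^+ 2| <= 1.
    by rewrite normr_div// ler_pdivrMr// mul1r.
  have := h01 x; rewrite !ler_norml; lra.
have flip x y : `|f x - f y| <= 2 * `|x - y| by apply: deriv_lip f'2.
(* Bounds |f|: by |f 0| + 2 on |x| <= 1, since f is 2-Lipschitz, and beyond by |x f| <= s^2. *)
pose B := `|f 0| + 2 + s ^+ 2.
have fB x : `|f x| <= B.
  have [x1|x1] := leP `|x| 1.
    have := flip x 0; rewrite subr0 => H.
    have := ler_normD (f x - f 0) (f 0); rewrite subrK /B; lra.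
  have := xf x; rewrite normrM => H.
  have : `|f x| <= `|x| * `|f x| by rewrite ler_peMl// ltW.
  by have := normr_ge0 (f 0); rewrite /B; lra.
have B0 : 2 <= B by rewrite /B; have := normr_ge0 (f 0); lra.
(* The three terms answer for |f'| <= 2, for the slope of the ramp, and for the variation of x f /
   s^2. *)
pose C := 2 + e^-1 + (B + 2) / s ^+ 2.
have ei : 0 < e^-1 by rewrite invr_gt0.
have Bs : 0 < (B + 2) / s ^+ 2 by rewrite divr_gt0//; lra.
exists f, f', C, c; split => //.
- by rewrite /C; lra.
(* c is the normal mean of the ramp, which is 1 up to a and 0 from a + e on. *)
- apply/andP; split.
    rewrite /c (Rintegral_split_at a); last exact: hint.
    rewrite Phi_Rintegral.
    have -> : \int[mu]_(t in `]-oo, a]) phi t = \int[mu]_(t in `]-oo, a]) (h t * phi t).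
      apply: eq_Rintegral => t; rewrite inE/= in_itv/= => ta.
      by rewrite /h ramp_le// mul1r.
    rewrite lerDl; apply: Rintegral_ge0 => t _.
    by rewrite mulr_ge0 ?normal_pdf_ge0//; have /andP[] := h01 t.
  rewrite /c (Rintegral_split_at (a + e)); last exact: hint.
  rewrite Phi_Rintegral.
  have -> : \int[mu]_(t in `](a+e), +oo[) (h t * phi t) = \int[mu]_(t in `](a+e), +oo[) (cst 0 t).
    apply: eq_Rintegral => t; rewrite inE/= in_itv/= andbT => ta.
    by rewrite /h ramp_ge ?mul0r// ltW.
  rewrite Rintegral_cst// mul0r addr0.
  apply: le_Rintegral => //; [exact: hint|exact: phi_integrable|].
  move=> t _; rewrite ler_piMl ?normal_pdf_ge0//.
  by have /andP[] := h01 t.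
split => [x|x y].
  by apply: le_trans (f'2 x) _; rewrite /C; lra.
have -> : f' x - f' y = (h x - h y) + ((x - y) * f y + x * (f x - f y)) / s ^+ 2.
  rewrite /f'; ring.
have H1 := ramp_lip a x y e0; have H2 := flip x y; have H3 := fB y.
apply: le_trans (ler_normD _ _) _.
have H4 : `|((x - y) * f y + x * (f x - f y)) / s ^+ 2| <= `|x - y| * ((B + 2 * `|x|) / s ^+ 2).
  rewrite normr_div//.
  rewrite [leRHS]mulrA ler_pM2r ?invr_gt0//.
  apply: le_trans (ler_normD _ _) _; rewrite (normrM (x - y)) (normrM x) mulrDr; apply: lerD.
    exact: ler_wpM2l.
  have -> : `|x - y| * (2 * `|x|) = `|x| * (2 * `|x - y|) by ring.
  exact: ler_wpM2l.
have : (B + 2 * `|x|) / s ^+ 2 <= (B + 2) / s ^+ 2 * (1 + `|x|).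
  rewrite mulrAC ler_pM2r ?invr_gt0//.
  have := normr_ge0 x; nra.
have := normr_ge0 x; have := normr_ge0 (x - y).
rewrite -/h in H1.
move: (`|x-y|) (`|x|) H1 H4 => u v H1 H4 u0 v0 H5.
have : u * ((B + 2 * v) / s ^+ 2) <= u * ((B + 2) / s ^+ 2 * (1 + v)) by exact: ler_wpM2l.
have : 0 <= u / e * v by rewrite mulr_ge0 // divr_ge0 // ltW.
have : 0 <= 2 * (1 + v) * u by rewrite !mulr_ge0//; lra.
move: H1 H4; rewrite /C; lra.
Qed.

End stein_equation.

Lemma Phi_lip (R : realType) (s a b : R) : 0 < s ->
  `|Phi s b - Phi s a| <= normal_peak s * `|b - a|.
Proof.
move=> s0; apply: (@deriv_lip _ (Phi s) (normal_pdf 0 s)) => x; last first.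
  by rewrite ger0_norm ?normal_pdf_ge0// normal_pdf_ub// gt_eqF.
have h1 : continuous (cst 1 : R -> R) by move=> y; exact: cvg_cst.
have h01 (y : R) : 0 <= cst (1 : R) y <= 1 by rewrite /= lexx ler01.
have D := stein_primitive_derive s0 0 h1 h01 x.
have -> : Phi s = (fun x0 => \int[lebesgue_measure]_(t in `]-oo, x0])
    ((cst (1 : R) t - 0) * normal_pdf 0 s t)).
  apply/funext => y; rewrite Phi_Rintegral; apply: eq_Rintegral => t _.
  by rewrite subr0 mul1r.
by apply: (is_derive_eq D); rewrite subr0 mul1r.
Qed.

(** * Stein's method for locally dependent sums *)

(** One application of the mean value theorem: the intermediate point is within |h| of x, and the
    Lipschitz bound is anchored at x, so the growth factor involves x alone. *)
Lemma deriv_taylor1 (R : realType) (f f' : R -> R) (C x h : R) : 0 < C ->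
  (forall x : R, is_derive x 1 f (f' x)) ->
  (forall x y, `|f' x - f' y| <= C * (1 + `|x|) * `|x - y|) ->
  `|f x - f (x - h) - h * f' x| <= C * (1 + `|x|) * h ^+ 2.
Proof.
move=> C0 fd fl.
have fc a b : {within `[a, b], continuous f}.
  apply: continuous_subspaceT => z; apply: differentiable_continuous.
  by apply/derivable1_diffP; have [] := fd z.
have [c cx ->] : exists2 c, `|x - c| <= `|h| & f x - f (x - h) = h * f' c.
  have [h0|h0] := leP 0 h.
    have ab : x - h <= x by lra.
    have [c cab ->] := @MVT_segment R f f' _ _ ab (fun x _ => fd x) (fc _ _).
    exists c; last by ring.
    by move: cab; rewrite in_itv/= => ?; rewrite !ger0_norm; lra.
  have ab : x <= x - h by lra.
  have [c cab E] := @MVT_segment R f f' _ _ ab (fun x _ => fd x) (fc _ _).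
  exists c.
    by move: cab; rewrite in_itv/= => ?; rewrite (ltr0_norm h0) ler0_norm; lra.
  by rewrite -[LHS]opprB E; ring.
rewrite -mulrBr normrM mulrC distrC expr2 -normr_id.
have -> : C * (1 + `|x|) * (h * h) = C * (1 + `|x|) * `|h| * `|h|.
  by rewrite -[h * h]expr2 -[h ^+ 2]real_normK ?num_real// expr2 !mulrA.
rewrite normr_id ler_wpM2r//; apply: le_trans (fl _ _) _.
by rewrite ler_wpM2l// mulr_ge0 ?ltW// addr_ge0.
Qed.

Section stein_method.
(** E is any positive normalized linear functional on all functions, so that the method applies to
    the finite recursion [Ex] without measurability or integrability conditions. *)
Variables (R : realType) (Omega : Type) (E : (Omega -> R) -> R).
Hypothesis E_lin : forall a F G, E (fun w => a * F w + G w) = a * E F + E G.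
Hypothesis E_le : forall F G, (forall w, F w <= G w) -> E F <= E G.
Hypothesis E_1 : E (fun=> 1) = 1.

Lemma mean_ext F G : (forall w, F w = G w) -> E F = E G.
Proof. by move=> FG; congr E; apply/funext. Qed.

Lemma mean0 : E (fun=> 0) = 0.
Proof.
have := E_lin (-1) (fun=> 1) (fun=> 1); by rewrite E_1 mulN1r addNr.
Qed.

Lemma meanZ a F : E (fun w => a * F w) = a * E F.
Proof. by rewrite -[RHS]addr0 -mean0 -E_lin; apply: mean_ext => w; rewrite addr0. Qed.

Lemma meanD F G : E (fun w => F w + G w) = E F + E G.
Proof. by rewrite -[E F]mul1r -E_lin; apply: mean_ext => w; rewrite mul1r. Qed.

Lemma meanB F G : E (fun w => F w - G w) = E F - E G.
Proof. by rewrite -[- E G]mulN1r -meanZ -meanD; apply: mean_ext => w; rewrite mulN1r. Qed.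

Lemma mean_cst a : E (fun=> a) = a.
Proof. by rewrite -[RHS]mulr1 -E_1 -meanZ; apply: mean_ext => w; rewrite mulr1. Qed.

Lemma mean_ge0 F : (forall w, 0 <= F w) -> 0 <= E F.
Proof. by move=> F0; rewrite -mean0; exact: E_le. Qed.

Lemma mean_sum (I : Type) (r : seq I) (P : pred I) (F : I -> Omega -> R) :
  E (fun w => \sum_(i <- r | P i) F i w) = \sum_(i <- r | P i) E (F i).
Proof.
elim: r => [|i r IH].
  by rewrite [RHS]big_nil -[RHS]mean0; apply: mean_ext => w; rewrite big_nil.
rewrite big_cons -IH; case: ifP => Pi; last first.
  by apply: mean_ext => w; rewrite big_cons Pi.
by rewrite -meanD; apply: mean_ext => w; rewrite big_cons Pi.
Qed.

Lemma mean_norm F : `|E F| <= E (fun w => `|F w|).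
Proof.
have H : E (fun w => -1 * F w) <= E (fun w => `|F w|).
  by apply: E_le => w; rewrite mulN1r -normrN ler_norm.
rewrite meanZ mulN1r in H; rewrite ler_norml lerNl H /=.
by apply: E_le => w; exact: ler_norm.
Qed.

(** Two neighbourhood relations are needed: eta_i collects the summands that may depend on xi_i,
    zeta_i those that may depend on the product xi_i eta_i. *)
Variables (n : nat) (xi : 'I_n -> Omega -> R) (nb1 nb2 : rel 'I_n).
Let W w := \sum_i xi i w.
Let eta i w := \sum_(j | nb1 i j) xi j w.
Let zeta i w := \sum_(j | nb2 i j) xi j w.
Hypothesis xi_mean : forall i, E (xi i) = 0.
Hypothesis xi_indep : forall i (u g : R -> R),
  E (fun w => u (xi i w) * g (W w - eta i w)) =
  E (fun w => u (xi i w)) * E (fun w => g (W w - eta i w)).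
Hypothesis xieta_indep : forall i (g : R -> R),
  E (fun w => xi i w * eta i w * g (W w - zeta i w)) =
  E (fun w => xi i w * eta i w) * E (fun w => g (W w - zeta i w)).
Variable d : R.
Hypothesis eta_d : forall i w, `|eta i w| <= d.
Hypothesis zeta_d : forall i w, `|zeta i w| <= d.

Let d0 (i : 'I_n) : 0 <= d.
Proof.
by rewrite -(mean_cst d); apply: mean_ge0 => w; exact: le_trans (eta_d i w).
Qed.

(** Expand W^2 as the sum of the xi_i W; the part W - eta_i is independent of the centred xi_i and
    drops out. *)
Lemma local_variance : E (fun w => W w ^+ 2) = \sum_i E (fun w => xi i w * eta i w).
Proof.
have -> : E (fun w => W w ^+ 2) = E (fun w => \sum_i xi i w * W w).
  by apply: mean_ext => w; rewrite expr2 {1}/W mulr_suml.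
rewrite mean_sum; apply: eq_bigr => i _.
have := xi_indep i id id; rewrite /= xi_mean mul0r => H.
by rewrite -[LHS]subr0 -H -meanB; apply: mean_ext => w; ring.
Qed.

Let M := 1 + 2 * d + E (fun w => `|W w|).

Let E_absW_ge0 : 0 <= E (fun w => `|W w|).
Proof. by apply: mean_ge0. Qed.

(** The factor 1 + |W| is not independent of xi_i. Passing to W - eta_i costs d, independence then
    splits the mean, and returning to W costs d again, whence 2 d in M. *)
Let E_xi_W i : E (fun w => `|xi i w| * (1 + `|W w|)) <= E (fun w => `|xi i w|) * M.
Proof.
apply: (@le_trans _ _ (E (fun w => `|xi i w| * (1 + d + `|W w - eta i w|)))).
  apply: E_le => w; apply: ler_wpM2l => //.
  have := ler_normD (W w - eta i w) (eta i w); rewrite subrK.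
  have := eta_d i w; lra.
rewrite (xi_indep i (fun x => `|x|) (fun x => 1 + d + `|x|)) ler_wpM2l ?mean_ge0//.
rewrite meanD mean_cst /M.
have : E (fun w => `|W w - eta i w|) <= E (fun w => `|W w| + d).
  apply: E_le => w; apply: le_trans (ler_normB _ _) _.
  by rewrite lerD2l eta_d.
rewrite meanD mean_cst; lra.
Qed.

Variables (f f' : R -> R) (C : R).
Hypothesis C0 : 0 < C.
Hypothesis fd : forall x : R, is_derive x 1 f (f' x).
Hypothesis fl : forall x y, `|f' x - f' y| <= C * (1 + `|x|) * `|x - y|.

Let S := \sum_i E (fun w => `|xi i w|).

(** The mean of xi_i f(W) is unchanged when xi_i f(W - eta_i) is subtracted; a Taylor step turns the
    difference into xi_i eta_i f'(W), and f'(W) is decoupled through f'(W - zeta_i). The constant 3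
    counts the Taylor remainder and the two terms of xi_i eta_i - k. *)
Lemma stein_local :
  `|E (fun w => W w * f (W w)) - E (fun w => W w ^+ 2) * E (fun w => f' (W w))|
    <= 3 * C * d ^+ 2 * S * M.
Proof.
have -> : E (fun w => W w * f (W w)) =
    \sum_i E (fun w => xi i w * (f (W w) - f (W w - eta i w))).
  have -> : E (fun w => W w * f (W w)) = E (fun w => \sum_i xi i w * f (W w)).
    by apply: mean_ext => w; rewrite {1}/W mulr_suml.
  rewrite mean_sum; apply: eq_bigr => i _.
  have := xi_indep i id f; rewrite /= xi_mean mul0r => H.
  by rewrite -[LHS]subr0 -H -meanB; apply: mean_ext => w; ring.
rewrite local_variance mulr_suml -sumrB.
rewrite mulrAC mulr_sumr; apply: le_trans (ler_norm_sum _ _ _) _.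
apply: ler_sum => i _.
set k := E (fun w => xi i w * eta i w).
(* The product (xi_i eta_i - k) f'(W - zeta_i) has mean 0, so it can be inserted. *)
have -> : E (fun w => xi i w * (f (W w) - f (W w - eta i w))) - k * E (fun w => f' (W w)) =
    E (fun w => xi i w * (f (W w) - f (W w - eta i w) - eta i w * f' (W w)) +
       (xi i w * eta i w - k) * (f' (W w) - f' (W w - zeta i w))).
  have H := xieta_indep i f'; rewrite -/k in H.
  rewrite -meanZ -meanB; apply/eqP; rewrite -subr_eq0 -meanB; apply/eqP.
  transitivity (E (fun w => xi i w * eta i w * f' (W w - zeta i w) - k * f' (W w - zeta i w))).
    by apply: mean_ext => w; ring.
  by rewrite meanB H meanZ subrr.
apply: le_trans (mean_norm _) _.
have kd : `|k| <= d * E (fun w => `|xi i w|).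
  apply: le_trans (mean_norm _) _; rewrite -meanZ; apply: E_le => w.
  by rewrite normrM mulrC ler_wpM2r.
apply: (@le_trans _ _ (E (fun w => 2 * C * d ^+ 2 * (`|xi i w| * (1 + `|W w|))
    + C * d * `|k| * (1 + `|W w|)))).
  apply: E_le => w.
  set A := 1 + `|W w|.
  have A0 : 0 <= A by rewrite addr_ge0.
  apply: le_trans (ler_normD _ _) _; rewrite normrM (normrM (_ - k)).
  have H1 : `|f (W w) - f (W w - eta i w) - eta i w * f' (W w)| <= C * A * d ^+ 2.
    apply: le_trans (deriv_taylor1 _ _ C0 fd fl) _.
    rewrite ler_wpM2l ?mulr_ge0 ?(ltW C0)//.
    by rewrite -[leLHS]real_normK ?num_real// lerXn2r ?nnegrE// (d0 i).
  have H2 : `|f' (W w) - f' (W w - zeta i w)| <= C * A * d.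
    apply: le_trans (fl _ _) _; rewrite subKr.
    by rewrite ler_wpM2l ?mulr_ge0 ?(ltW C0).
  have H3 : `|xi i w * eta i w - k| <= d * `|xi i w| + `|k|.
    apply: le_trans (ler_normB _ _) _; rewrite lerD2r normrM mulrC.
    by rewrite ler_wpM2r.
  have H4 := ler_pM (normr_ge0 _) (normr_ge0 _) H3 H2.
  have H5 := ler_wpM2l (normr_ge0 (xi i w)) H1.
  apply: le_trans (lerD H5 H4) _.
  by rewrite le_eqVlt; apply/orP; left; apply/eqP; ring.
rewrite meanD !meanZ.
have H1 := E_xi_W i.
have MB : E (fun w => 1 + `|W w|) <= M.
  by rewrite meanD E_1 /M; have := d0 i; lra.
have EB : 0 <= E (fun w => 1 + `|W w|) by apply: mean_ge0 => w; rewrite addr_ge0.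
have Cd : 0 <= C * d by rewrite mulr_ge0 ?(ltW C0) ?(d0 i).
have H2 : `|k| * E (fun w => 1 + `|W w|) <= d * E (fun w => `|xi i w|) * M by exact: ler_pM.
have H3 := ler_wpM2l Cd H2.
have Cd2 : 0 <= 2 * C * d ^+ 2 by rewrite !mulr_ge0 ?(ltW C0) ?(d0 i).
have H4 := ler_wpM2l Cd2 H1.
rewrite mulrA in H3.
apply: le_trans (lerD H4 H3) _.
by rewrite le_eqVlt; apply/orP; left; apply/eqP; ring.
Qed.

End stein_method.

(** * Independent Bernoulli sequences *)

Section bernoulli_expectation.
Variables (R : realType) (rr : nat -> R).
Hypothesis rr01 : forall i, 0 <= rr i <= 1.
Implicit Types (b : nat -> bool) (F G : (nat -> bool) -> R).

Definition upd b (i : nat) (x : bool) : nat -> bool := fun j => if j == i then x else b j.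

(* Ex n F b integrates out the coordinates i < n, which are independent Bernoulli(rr i), and keeps the
   others as in b; independence of functions of disjoint coordinates is then an induction on n. *)
Definition avg i F b : R := rr i * F (upd b i true) + (1 - rr i) * F (upd b i false).

Fixpoint Ex n F b : R := if n is n'.+1 then Ex n' (avg n' F) b else F b.

Definition free F i := forall b x, F (upd b i x) = F b.

Lemma upd_upd b i x y : upd (upd b i x) i y = upd b i y.
Proof. by apply/funext => j; rewrite /upd; case: eqP. Qed.

Lemma upd_comm b i j x y : i != j -> upd (upd b i x) j y = upd (upd b j y) i x.
Proof.
move=> ij; apply/funext => k; rewrite /upd.
case: (eqVneq k i) => [E|_]; case: (eqVneq k j) => [E'|_] //.
by rewrite -E -E' eqxx in ij.
Qed.

Lemma upd_same b i j x : i != j -> upd b j x i = b i.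
Proof. by rewrite /upd => /negbTE ->. Qed.

Lemma avg_free F i : free F i -> avg i F = F.
Proof. by move=> Ff; apply/funext => b; rewrite /avg !Ff; ring. Qed.

Lemma free_avg F i j : free F i -> free (avg j F) i.
Proof.
move=> Fi b x; rewrite /avg; have [<-|ij] := eqVneq i j; first by rewrite !upd_upd.
by rewrite !(upd_comm _ _ _ ij) !Fi.
Qed.

Lemma Ex_lin n (a : R) F G b :
  Ex n (fun w => a * F w + G w) b = a * Ex n F b + Ex n G b.
Proof.
elim: n F G => // n IH F G /=; rewrite -IH; congr (Ex n _ b).
by apply/funext => w; rewrite /avg; ring.
Qed.

Lemma Ex_le n F G b : (forall w, F w <= G w) -> Ex n F b <= Ex n G b.
Proof.
elim: n F G => [F G|n IH F G FG] /=; first by apply.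
by apply: IH => w; rewrite /avg lerD// ler_wpM2l//; have := rr01 n; lra.
Qed.

Lemma Ex_1 n b : Ex n (fun=> 1) b = 1.
Proof.
elim: n => //= n IH; rewrite -[RHS]IH; congr (Ex n _ b).
by apply/funext => w; rewrite /avg; ring.
Qed.

Lemma Ex_0 n b : Ex n (fun=> 0) b = 0.
Proof. exact: (@mean0 _ _ (fun F => Ex n F b) (fun a F G => Ex_lin n a F G b) (Ex_1 n b)). Qed.

Lemma Ex_mul n F G b : (forall i, (i < n)%N -> free F i \/ free G i) ->
  Ex n (fun w => F w * G w) b = Ex n F b * Ex n G b.
Proof.
elim: n F G => //= n IH F G H.
rewrite -IH => [|i iltn]; last first.
  by have [] := H i (ltnW iltn); [left|right]; exact: free_avg.
congr (Ex n _ b); apply/funext => w; have [Ff|Gf] := H n (leqnn _).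
  by rewrite (avg_free Ff) /avg !Ff; ring.
by rewrite (avg_free Gf) /avg !Gf; ring.
Qed.

Lemma Ex_free_widen m n F b : (m <= n)%N -> (forall i, (m <= i)%N -> free F i) ->
  Ex n F b = Ex m F b.
Proof.
move=> + Ff; elim: n => [|n IH]; first by rewrite leqn0 => /eqP ->.
rewrite leq_eqVlt ltnS => /predU1P[-> //|mn].
by rewrite /= avg_free ?IH//; exact: Ff.
Qed.

Definition norec m j b : R := \prod_(m <= i < j) (~~ b i)%:R.

Lemma norec_free m j i : (i < m)%N || (j <= i)%N -> free (norec m j) i.
Proof.
move=> H b x; apply: eq_big_nat => k /andP[mk kj].
rewrite upd_same//; apply: contraTN H => /eqP <-.
by rewrite negb_or -leqNgt mk -ltnNge.
Qed.

Lemma Ex_norec m j b : Ex j (norec m j) b = \prod_(m <= i < j) (1 - rr i).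
Proof.
have [mj|jm] := leqP m j; last first.
  rewrite big_geq 1?ltnW// -[RHS](Ex_1 j b); congr (Ex j _ b).
  by apply/funext => w; rewrite /norec big_geq 1?ltnW.
elim: j mj => [|j IH]; first by rewrite leqn0 => /eqP ->; rewrite /norec /= !big_geq.
rewrite leq_eqVlt => /predU1P[->|].
  rewrite big_geq// -[RHS](Ex_1 j.+1 b); congr (Ex j.+1 _ b).
  by apply/funext => w; rewrite /norec big_geq.
rewrite ltnS => mj; rewrite big_nat_recr//= -IH//.
have -> : avg j (norec m j.+1) = (fun w => (1 - rr j) * norec m j w + 0).
  apply/funext => w; rewrite /avg /norec !big_nat_recr//=; rewrite -!/(norec m j _).
  rewrite !norec_free ?leqnn ?orbT// {2}/upd /upd eqxx /=; ring.
by rewrite Ex_lin Ex_0 addr0 mulrC.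
Qed.

Variable delta : nat.

(** The clause [delta < j] carries the convention M_0 = 0: every threshold M_(k-1) + delta is at
    least delta. It also keeps j - delta from being truncated. *)
Definition drec b j : bool := [&& (delta < j)%N, b j & all (fun i => ~~ b i) (index_iota (j - delta) j)].

Definition qrec j : R := if (delta < j)%N then rr j * \prod_(j - delta <= i < j) (1 - rr i) else 0.

Lemma drecE b j : (drec b j)%:R = (delta < j)%:R * (b j)%:R * norec (j - delta) j b :> R.
Proof.
rewrite /drec -!mulnb !natrM mulrA; congr (_ * _).
rewrite /norec; elim: (index_iota _ _) => [|i s IH]; first by rewrite big_nil.
by rewrite big_cons /= -mulnb natrM IH.
Qed.

Lemma drec_free j i : (i + delta < j)%N || (j < i)%N -> free (fun b => (drec b j)%:R : R) i.
Proof.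
move=> H b x; rewrite !drecE norec_free; last first.
  by case/orP: H => H; apply/orP; [left; lia|right; lia].
by rewrite upd_same//; apply: contraTN H => /eqP ->; lia.
Qed.

Lemma Ex_drec n j b : (j < n)%N -> Ex n (fun b => (drec b j)%:R) b = qrec j.
Proof.
move=> jn; rewrite (@Ex_free_widen j.+1)//; last first.
  by move=> i ji; apply: drec_free; rewrite ji orbT.
rewrite /= /qrec.
have -> : avg j (fun b => (drec b j)%:R) =
   (fun w => ((delta < j)%:R * rr j) * norec (j - delta) j w + 0).
  apply/funext => w; rewrite /avg !drecE !norec_free ?leqnn ?orbT// /upd eqxx /=.
  by rewrite !mulr0 mul0r mulr0 !addr0 mulr1 mulrA (mulrC (rr j)).
rewrite Ex_lin Ex_0 addr0.
by rewrite Ex_norec; case: ifP => _; rewrite ?mul1r// !mul0r.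
Qed.

Lemma drec_excl b i j : (i < j)%N -> (j <= i + delta)%N -> drec b i -> drec b j -> False.
Proof.
move=> ij jd /and3P[_ bi _] /and3P[_ _ /allP /(_ i)].
by rewrite mem_index_iota bi ij andbT leq_subLR addnC jd => /(_ isT).
Qed.

Lemma qrec_ge0 j : 0 <= qrec j.
Proof.
rewrite /qrec; case: ifP => // _; rewrite mulr_ge0//; first by have /andP[] := rr01 j.
by apply: prodr_ge0 => i _; rewrite subr_ge0; have /andP[] := rr01 i.
Qed.

Lemma qrec_le j : qrec j <= rr j.
Proof.
rewrite /qrec; case: ifP => _; last by have /andP[] := rr01 j.
rewrite ler_piMr//; first by have /andP[] := rr01 j.
by apply: prodr_ile1 => i; have := rr01 i; lra.
Qed.

Lemma qrec_le1 j : qrec j <= 1.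
Proof. by apply: le_trans (qrec_le j) _; have /andP[] := rr01 j. Qed.

Definition Usum K b : nat := (\sum_(j < K) drec b j)%N.

Definition near_idx m (i j : nat) := (i <= j + m)%N && (j <= i + m)%N.

Lemma near_idx_card m K (i : nat) : (#|[pred j : 'I_K | near_idx m i j]| <= m.*2.+1)%N.
Proof.
rewrite cardE -(size_map val) -[leqRHS](size_iota (i - m)).
apply: uniq_leq_size; first by rewrite map_inj_uniq ?enum_uniq//; exact: val_inj.
move=> k /mapP[j]; rewrite mem_enum inE /near_idx => /andP[h1 h2] ->.
by rewrite mem_iota /=; apply/andP; split; lia.
Qed.

Definition Umean K : R := \sum_(i < K) qrec i.

(** The inner sum includes j = i: the diagonal contributes the Bernoulli variance q_i - q_i^2, and
    each ordered pair of distinct neighbours the covariance - q_i q_j. *)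
Definition Uvar K : R := \sum_(i < K) qrec i * (1 - \sum_(j < K | near_idx delta i j) qrec j).

End bernoulli_expectation.

(** * Central limit theorem for the number of delta-record values below a level *)

Section delta_record_clt.
Variables (R : realType) (rr : nat -> R).
Hypothesis rr01 : forall i, 0 <= rr i <= 1.
Variables (delta : nat) (b0 : nat -> bool).

Section fixed_range.
Variables (K : nat) (B : R).
Hypothesis B0 : 0 < B.
Local Notation q := (qrec rr delta).
Let E F := Ex rr K F b0.
Let xi (i : 'I_K) (b : nat -> bool) : R := ((drec delta b i)%:R - q i) / B.
Let nb m : rel 'I_K := fun i j => near_idx m i j.
(** Number of integers within 2 delta of a given one, the larger of the two neighbourhoods. *)
Let D : R := (4 * delta + 1)%:R.

Let E_lin a F G : E (fun w => a * F w + G w) = a * E F + E G.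
Proof. exact: Ex_lin. Qed.
Let E_le F G : (forall w, F w <= G w) -> E F <= E G.
Proof. exact: Ex_le. Qed.
Let E_1 : E (fun=> 1) = 1. Proof. exact: Ex_1. Qed.

Let xi_free (i : 'I_K) k : (k + delta < i)%N || (i < k)%N -> free (xi i) k.
Proof. by move=> H b x; rewrite /xi (drec_free R H). Qed.

Let sum_free (P : pred 'I_K) k : (forall i, P i -> (k + delta < i)%N || (i < k)%N) ->
  free (fun w => \sum_(i | P i) xi i w) k.
Proof. by move=> H b x; apply: eq_bigr => i Pi; apply: xi_free; exact: H. Qed.

Let comp_free F (g : R -> R) k : free F k -> free (fun w => g (F w)) k.
Proof. by move=> H b x; rewrite H. Qed.

Let E_drec (i : 'I_K) : E (fun w => (drec delta w i)%:R) = q i.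
Proof. exact: Ex_drec. Qed.

Let xi_mean (i : 'I_K) : E (xi i) = 0.
Proof.
rewrite (_ : xi i = fun w => B^-1 * (drec delta w i)%:R + (- (q i / B))); last first.
  by apply/funext => w; rewrite /xi; ring.
by rewrite E_lin (mean_cst E_lin E_1) E_drec; ring.
Qed.

Let split_sum m (i : 'I_K) w :
  \sum_j xi j w - \sum_(j | nb m i j) xi j w = \sum_(j | ~~ nb m i j) xi j w.
Proof. by rewrite [X in X - _](bigID (nb m i)) /= addrAC subrr add0r. Qed.

Let xi_indep (i : 'I_K) (u g : R -> R) :
  E (fun w => u (xi i w) * g (\sum_j xi j w - \sum_(j | nb delta i j) xi j w)) =
  E (fun w => u (xi i w)) * E (fun w => g (\sum_j xi j w - \sum_(j | nb delta i j) xi j w)).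
Proof.
apply: Ex_mul => k kK.
have [H|H] := boolP ((k + delta < i)%N || (i < k)%N).
  by left; apply: comp_free; exact: xi_free.
right; apply: comp_free => b x; rewrite !split_sum; apply: sum_free => j.
rewrite /nb /near_idx; lia.
Qed.

(** The product xi_i eta_i reads the coordinates i - 2 delta, ..., i + delta. A summand of index j
    reads j - delta, ..., j, so outside radius 2 delta it reads none of them. *)
Let xieta_indep (i : 'I_K) (g : R -> R) :
  E (fun w => xi i w * (\sum_(j | nb delta i j) xi j w)
     * g (\sum_j xi j w - \sum_(j | nb delta.*2 i j) xi j w)) =
  E (fun w => xi i w * (\sum_(j | nb delta i j) xi j w)) *
  E (fun w => g (\sum_j xi j w - \sum_(j | nb delta.*2 i j) xi j w)).
Proof.
apply: Ex_mul => k kK.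
have [H|H] := boolP ((k + delta.*2 < i)%N || (i + delta < k)%N).
  left => b x; congr (_ * _).
    apply: xi_free; lia.
  apply: sum_free => j; rewrite /nb /near_idx; lia.
right; apply: comp_free => b x; rewrite !split_sum; apply: sum_free => j.
rewrite /nb /near_idx; lia.
Qed.

Let xi_le (i : 'I_K) w : `|xi i w| <= B^-1.
Proof.
rewrite normr_div// -[leRHS]mul1r ler_pM2r ?invr_gt0//.
have := qrec_ge0 rr01 delta i; have := qrec_le1 rr01 delta i.
by case: (drec _ _ _) => /=; rewrite ler_norml; lra.
Qed.

Let sum_xi_le m (i : 'I_K) w : (m.*2.+1 <= 4 * delta + 1)%N ->
  `|\sum_(j | nb m i j) xi j w| <= D / B.
Proof.
move=> mD; apply: le_trans (ler_norm_sum _ _ _) _.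
apply: (@le_trans _ _ (\sum_(j | nb m i j) B^-1)); first exact: ler_sum.
rewrite sumr_const -[leLHS]mulr_natl ler_pM2r ?invr_gt0// ler_nat.
exact: leq_trans (near_idx_card m K i) _.
Qed.

Let W w := \sum_i xi i w.

Lemma delta_record_sumE w : W w = ((Usum delta K w)%:R - Umean rr delta K) / B.
Proof.
by rewrite /W /xi -mulr_suml sumrB; congr ((_ - _) / _); rewrite /Usum natr_sum.
Qed.

Lemma delta_record_variance : E (fun w => W w ^+ 2) = Uvar rr delta K / B ^+ 2.
Proof.
rewrite (local_variance E_lin E_1 xi_mean xi_indep).
rewrite /Uvar mulr_suml; apply: eq_bigr => i _.
have -> : E (fun w => xi i w * \sum_(j | nb delta i j) xi j w) =
    E (fun w => \sum_(j | nb delta i j) xi i w * xi j w).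
  by congr (Ex _ _ _ _); apply/funext => w; rewrite mulr_sumr.
rewrite (mean_sum E_lin E_1) mulrBr mulr1.
have cov j : nb delta i j -> E (fun w => xi i w * xi j w) =
    ((if i == j then q i else 0) - q i * q j) / B ^+ 2.
  move=> nbij.
  have -> : E (fun w => xi i w * xi j w) = (B^-1) ^+ 2 *
    E (fun w => (drec delta w i)%:R * (drec delta w j)%:R + (- q i) * ((drec delta w j)%:R)
      + (- q j) * ((drec delta w i)%:R) + q i * q j).
    rewrite -(meanZ E_lin E_1); congr (Ex _ _ _ _); apply/funext => w; rewrite /xi; ring.
  rewrite !(meanD E_lin) !(meanZ E_lin E_1) (mean_cst E_lin E_1) !E_drec.
  have -> : E (fun w => (drec delta w i)%:R * (drec delta w j)%:R) = if i == j then q i else 0.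
    case: eqVneq => [<-|ij].
      rewrite -(E_drec i); congr (Ex _ _ _ _); apply/funext => w.
      by case: drec; rewrite ?mulr1 ?mulr0.
    rewrite -[RHS](mean0 E_lin E_1); congr (Ex _ _ _ _); apply/funext => w.
    rewrite -natrM mulnb; case: (boolP (_ && _)) => // /andP[di dj].
    move: nbij ij; rewrite /nb /near_idx => /andP[h1 h2]; rewrite -val_eqE /= neq_ltn.
    case/orP => h; first by case: (drec_excl h h2 di dj).
    by case: (drec_excl h h1 dj di).
  by field; rewrite gt_eqF.
rewrite (eq_bigr _ cov) -mulr_suml; congr (_ / _); rewrite sumrB -mulr_sumr; congr (_ - _).
rewrite (bigD1 i)/= ?eqxx; last by rewrite /nb /near_idx leq_addr.
rewrite big1 ?addr0// => j /andP[_ /negbTE]; by rewrite eq_sym => ->.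
Qed.

Let E_absW : E (fun w => `|W w|) <= 1 + Uvar rr delta K / B ^+ 2.
Proof.
rewrite -delta_record_variance -[X in X + _]E_1 -(meanD E_lin); apply: E_le => w.
rewrite -[W w ^+ 2]real_normK ?num_real//; nra.
Qed.

Let E_abs_xi : \sum_i E (fun w => `|xi i w|) <= 2 * Umean rr delta K / B.
Proof.
rewrite /Umean mulr_sumr mulr_suml; apply: ler_sum => i _.
apply: (@le_trans _ _ (E (fun w => B^-1 * (drec delta w i)%:R + q i / B))).
  apply: E_le => w; have -> : B^-1 * (drec delta w i)%:R + q i / B = ((drec delta w i)%:R + q i) / B by ring.
  rewrite normr_div// ler_pM2r ?invr_gt0//.
  apply: le_trans (ler_normB _ _) _; rewrite lerD// ger0_norm ?ler0n//.
  exact: qrec_ge0.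
by rewrite E_lin (mean_cst E_lin E_1) E_drec le_eqVlt; apply/orP; left; apply/eqP; ring.
Qed.

(** With v = E W^2, taking means in the Stein equation gives s^2 (E h(W) - c) = (s^2 - v) E f'(W) -
    (E W f(W) - v E f'(W)). In the local bound, the E |xi_i| sum to at most 2 [Umean] / B, and E |W|
    <= 1 + v. *)
Lemma delta_record_stein_bound (s C c : R) (h f f' : R -> R) :
  0 < C -> (forall x : R, is_derive x 1 f (f' x)) ->
  (forall x, s ^+ 2 * f' x - x * f x = s ^+ 2 * (h x - c)) ->
  (forall x, `|f' x| <= C) ->
  (forall x y, `|f' x - f' y| <= C * (1 + `|x|) * `|x - y|) ->
  let v := Uvar rr delta K / B ^+ 2 in
  s ^+ 2 * `|Ex rr K (fun w => h (((Usum delta K w)%:R - Umean rr delta K) / B)) b0 - c|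
   <= `|s ^+ 2 - v| * C
      + 3 * C * (D / B) ^+ 2 * (2 * Umean rr delta K / B) * (2 + 2 * (D / B) + v).
Proof.
move=> C0 fd eqn f'C fl; rewrite /=; set v := Uvar _ _ _ / _.
have eta_d (i : 'I_K) w : `|\sum_(j | nb delta i j) xi j w| <= D / B.
  by apply: sum_xi_le; lia.
have zeta_d (i : 'I_K) w : `|\sum_(j | nb delta.*2 i j) xi j w| <= D / B.
  by apply: sum_xi_le; lia.
have H := stein_local E_lin E_le E_1 xi_mean xi_indep xieta_indep eta_d zeta_d C0 fd fl.
rewrite -/W delta_record_variance -/v in H.
rewrite -[X in X * `|_|]ger0_norm ?sqr_ge0// -normrM.
have -> : s ^+ 2 * (Ex rr K (fun w => h (((Usum delta K w)%:R - Umean rr delta K) / B)) b0 - c)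
   = (s ^+ 2 - v) * E (fun w => f' (W w)) - (E (fun w => W w * f (W w)) - v * E (fun w => f' (W w))).
  transitivity (E (fun w => s ^+ 2 * f' (W w) - W w * f (W w))).
    rewrite -[in LHS](mean_cst E_lin E_1 c) -/E -(meanB E_lin E_1) -(meanZ E_lin E_1).
    by congr (Ex _ _ _ _); apply/funext => w; rewrite eqn delta_record_sumE.
  by rewrite (meanB E_lin E_1) (meanZ E_lin E_1); ring.
apply: le_trans (ler_normB _ _) _; apply: lerD.
  rewrite normrM ler_wpM2l//; apply: le_trans (mean_norm E_lin E_le E_1 _) _.
  by rewrite -[leRHS](mean_cst E_lin E_1); exact: E_le.
apply: le_trans H _.
have D0 : 0 <= D / B by rewrite divr_ge0 ?ler0n // ltW.
have S0 : 0 <= \sum_i E (fun w => `|xi i w|).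
  by apply: sumr_ge0 => i _; apply: (mean_ge0 E_lin E_le E_1).
have W0 : 0 <= E (fun w => `|W w|) by apply: (mean_ge0 E_lin E_le E_1).
have C1 : 0 <= 3 * C * (D / B) ^+ 2 by rewrite mulr_ge0 ?exprn_ge0// mulr_ge0 // ltW.
apply: ler_pM.
- exact: mulr_ge0.
- rewrite -/W; lra.
- by rewrite ler_wpM2l.
- rewrite -/W; have := E_absW; rewrite -/v; lra.
Qed.

End fixed_range.

(** Once the mean is at most A B^2, the local error is of order 1 / B. The limit is given only
    through its bracketing by [Phi], which is all that the sandwich of distribution functions
    requires. *)
Lemma delta_record_clt_ramp (K : nat -> nat) (B : nat -> R) (A s a e : R) :
  0 < s -> 0 < e ->
  B @ \oo --> +oo ->
  (fun n => Uvar rr delta (K n) / B n ^+ 2) @ \oo --> s ^+ 2 ->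
  (\forall n \near \oo, Umean rr delta (K n) <= A * B n ^+ 2) ->
  exists2 c, Phi s a <= c <= Phi s (a + e) &
    (fun n => Ex rr (K n) (fun w =>
       ramp a e (((Usum delta (K n) w)%:R - Umean rr delta (K n)) / B n)) b0) @ \oo --> c.
Proof.
move=> s0 e0 Boo Vs UA.
have [f [f' [C [c [C0 cP fd eqn [f'C fl]]]]]] := stein_equation a s0 e0.
exists c => //.
pose v n := Uvar rr delta (K n) / B n ^+ 2.
pose D : R := (4 * delta + 1)%:R.
pose bd n := (`|s ^+ 2 - v n| * C
   + (6 * C * D ^+ 2 * A) * (B n)^-1 * (2 + 2 * (D * (B n)^-1) + v n)) / s ^+ 2.
have Bpos : \forall n \near \oo, 0 < B n by move/cvgryPgt : Boo; exact.
have Bi : (fun n => (B n)^-1) @ \oo --> (0 : R).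
  exact: (gtr0_cvgV0 Bpos).2.
have bd0 : bd @ \oo --> (0 : R).
  rewrite -(mul0r (s ^+ 2)^-1); apply: cvgM; last exact: cvg_cst.
  have -> : 0 = `|s ^+ 2 - s ^+ 2| * C + (6 * C * D ^+ 2 * A) * 0 * (2 + 2 * (D * 0) + s ^+ 2) :> R.
    by rewrite subrr normr0; ring.
  apply: cvgD.
    apply: cvgM; last exact: cvg_cst.
    by apply: cvg_norm; apply: cvgB => //; exact: cvg_cst.
  apply: cvgM; first by apply: cvgM => //; exact: cvg_cst.
  apply: cvgD => //; apply: cvgD; first exact: cvg_cst.
  by apply: cvgM; [exact: cvg_cst|apply: cvgM => //; exact: cvg_cst].
apply/cvgrPdist_le => eps eps0.
move/cvgrPdist_le : bd0 => /(_ _ eps0) bd0.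
near=> n.
have Bn0 : 0 < B n by near: n.
have UAn : Umean rr delta (K n) <= A * B n ^+ 2 by near: n.
have : `|0 - bd n| <= eps by near: n.
rewrite sub0r normrN; apply: le_trans; rewrite distrC.
apply: le_trans (ler_norm _).
have s2 : 0 < s ^+ 2 by rewrite exprn_gt0.
rewrite /bd ler_pdivlMr// mulrC.
apply: le_trans (delta_record_stein_bound _ Bn0 C0 fd eqn f'C fl) _.
rewrite -/(v n) -/D lerD2l.
have v0 : 0 <= v n.
  rewrite /v -(delta_record_variance _ Bn0) -(Ex_0 rr (K n) b0); apply: Ex_le => // w.
  exact: sqr_ge0.
have D0 : 0 <= D by rewrite ler0n.
apply: ler_wpM2r; first by rewrite !addr_ge0// mulr_ge0// divr_ge0// ltW.
have -> : 6 * C * D ^+ 2 * A * (B n)^-1 = 3 * C * (D / B n) ^+ 2 * (2 * (A * B n ^+ 2) / B n).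
  by field; rewrite gt_eqF.
rewrite ler_wpM2l//; first by rewrite mulr_ge0 ?exprn_ge0 ?divr_ge0// ?(ltW Bn0)// mulr_ge0 // ltW.
by rewrite ler_pM2r ?invr_gt0// ler_pM2l.
Unshelve. all: by end_near. Qed.

End delta_record_clt.

(** * Record values of an i.i.d. sequence *)

Section discrete_functions.
Context {d : measure_display} {T : measurableType d}.

(** Measurability through level sets: for countable values it passes to arbitrary functions, pairs
    and lists without a sigma-algebra on the target. *)
Definition discrete_measurable (C : countType) (g : T -> C) :=
  forall c, measurable [set w | g w = c].

Lemma discrete_measurable_set (C : countType) (g : T -> C) (Q : C -> Prop) :
  discrete_measurable g -> measurable [set w | Q (g w)].
Proof.
move=> mg.
have -> : [set w | Q (g w)] = \bigcup_n (if @unpickle C n is Some c then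
    (if `[< Q c >] then [set w | g w = c] else set0) else set0).
  apply/seteqP; split => [w Qw|w [n _]] /=.
    by exists (pickle (g w)) => //; rewrite pickleK; case: asboolP.
  by case: unpickle => // c; case: asboolP => // Qc /= ->.
apply: bigcup_measurable => n _; case: unpickle => // c.
by case: ifP.
Qed.

Lemma discrete_measurable_comp (C C' : countType) (g : T -> C) (h : C -> C') :
  discrete_measurable g -> discrete_measurable (h \o g).
Proof. by move=> mg c; exact: (discrete_measurable_set (fun x => h x = c) mg). Qed.

Lemma discrete_measurable_pair (C C' : countType) (g : T -> C) (h : T -> C') :
  discrete_measurable g -> discrete_measurable h ->
  discrete_measurable (fun w => (g w, h w)).
Proof.
move=> mg mh [c c'].
have -> : [set w | (g w, h w) = (c, c')] = [set w | g w = c] `&` [set w | h w = c'].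
  by apply/seteqP; split => w /= [-> ->].
exact: measurableI.
Qed.

Lemma discrete_measurable_cst (C : countType) (c : C) : discrete_measurable (fun=> c).
Proof.
move=> c'; have [<-|cc'] := eqVneq c c'.
  by rewrite (_ : [set _ | _] = setT)//; apply/seteqP; split.
rewrite (_ : [set _ | _] = set0)//; apply/seteqP; split => // w /= E.
by rewrite E eqxx in cc'.
Qed.

Lemma discrete_measurable_map (C : countType) (g : nat -> T -> C) (s : seq nat) :
  (forall i, i \in s -> discrete_measurable (g i)) -> discrete_measurable (fun w => [seq g i w | i <- s]).
Proof.
elim: s => [|i s IH] H; first exact: discrete_measurable_cst.
have := discrete_measurable_pair (H i (mem_head _ _))
  (IH (fun j js => H j (mem_behead (s := i :: s) js))).
exact: (discrete_measurable_comp (fun x => x.1 :: x.2)).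
Qed.

End discrete_functions.

Section real_probability.
Context {d : measure_display} {T : measurableType d} {R : realType} (P : probability T R).

Definition pr (A : set T) : R := fine (P A).

Lemma prE A : measurable A -> P A = (pr A)%:E.
Proof. by move=> mA; rewrite /pr fineK// fin_num_measure. Qed.

Lemma pr_ge0 A : 0 <= pr A.
Proof. by rewrite /pr fine_ge0. Qed.

Lemma prT : pr setT = 1.
Proof. by rewrite /pr probability_setT. Qed.

Lemma pr0 : pr set0 = 0.
Proof. by rewrite /pr measure0. Qed.

Lemma pr_le A B : measurable A -> measurable B -> A `<=` B -> pr A <= pr B.
Proof. by move=> mA mB AB; rewrite -lee_fin -!prE//; apply: le_measure; rewrite ?inE. Qed.

Lemma prD A B : measurable A -> measurable B -> (forall w, A w -> B w -> False) ->
  pr (A `|` B) = pr A + pr B.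
Proof.
move=> mA mB AB; apply: EFin_inj; rewrite EFinD -!prE//; last exact: measurableU.
by apply: measureU => //; rewrite -subset0 => w [] /AB; exact.
Qed.

Lemma prU_le A B : measurable A -> measurable B -> pr (A `|` B) <= pr A + pr B.
Proof.
move=> mA mB.
have mBA : measurable (B `\` A) by exact: measurableD.
have -> : A `|` B = A `|` (B `\` A).
  apply/seteqP; split => [w [|Bw]|w [|[]]]; [by left| |by left|by right].
  by have [Aw|nA] := pselect (A w); [left|right].
rewrite prD//; last by move=> w Aw [].
by rewrite lerD2l pr_le// => w [].
Qed.

Lemma prC A : measurable A -> pr (~` A) = 1 - pr A.
Proof.
move=> mA; rewrite -prT -(setvU A) prD ?addrK//; first exact: measurableC.
Qed.

Lemma pr_split A B : measurable A -> measurable B ->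
  pr A = pr (A `&` B) + pr (A `&` ~` B).
Proof.
move=> mA mB; rewrite -prD; first by rewrite -setIUr setUv setIT.
- exact: measurableI.
- by apply: measurableI => //; exact: measurableC.
by move=> w [_ ?] [_].
Qed.

Lemma pr_level_sum (A : set T) (g : T -> nat) k : measurable A -> discrete_measurable g ->
  pr (A `&` [set w | (g w < k)%N]) = \sum_(c < k) pr (A `&` [set w | g w = c]).
Proof.
move=> mA mg; elim: k => [|k IH].
  by rewrite big_ord0 -[RHS]pr0; congr pr; apply/seteqP; split => w [].
rewrite big_ord_recr/= -IH -prD.
- congr pr; apply/seteqP; split => w /=.
    by case=> Aw; rewrite ltnS leq_eqVlt => /predU1P[->|?]; [right|left].
  by case=> [[Aw gk]|[Aw ->]]; split => //; exact: ltnW.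
- by apply: measurableI => //; exact: (discrete_measurable_set (fun x => x < k)%N mg).
- exact: measurableI.
- by move=> w [_ /= gk] [_ gE]; rewrite gE ltnn in gk.
Qed.

End real_probability.

(** * Tail probabilities, hazard rates and the threshold m(t) *)

Section tail_sequence.
Variables (R : realType) (p : nat -> R).
Hypotheses (hp : forall k, 0 < p k) (hsum : series p @ \oo --> (1 : R)).

Lemma ytailE k : ytail p k = 1 - \sum_(i < k.+1) p i.
Proof.
rewrite /ytail; apply: cvg_lim => //.
have : (fun n => series p n - \sum_(i < k.+1) p i) @ \oo --> 1 - \sum_(i < k.+1) p i.
  by apply: cvgB => //; exact: cvg_cst.
apply: cvg_trans; apply: near_eq_cvg; near=> n.
have kn : (k.+1 <= n)%N by near: n; exact: nbhs_infty_ge.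
by rewrite /series /= (@big_cat_nat _ _ _ k.+1)//= big_mkord addrAC subrr add0r.
Unshelve. all: by end_near. Qed.

Lemma yprevE k : yprev p k = 1 - \sum_(i < k) p i.
Proof. by case: k => [|k]; rewrite ?big_ord0 ?subr0//= ytailE. Qed.

Lemma yprevS k : yprev p k.+1 = yprev p k - p k.
Proof. by rewrite !yprevE big_ord_recr /=; ring. Qed.

Lemma yprev_cvg0 : yprev p @ \oo --> (0 : R).
Proof.
have -> : yprev p = fun k => 1 - series p k.
  by apply/funext => k; rewrite yprevE /series /= big_mkord.
by rewrite -[X in _ --> X](subrr 1); apply: cvgB => //; exact: cvg_cst.
Qed.

Lemma yprev_nincr : {homo yprev p : i j / (i <= j)%N >-> j <= i}.
Proof.
apply/nonincreasing_seqP => k; rewrite yprevS; have := hp k; lra.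
Qed.

Lemma yprev_gt0 k : 0 < yprev p k.
Proof.
have : 0 <= yprev p k.+1.
  have := nonincreasing_cvgn_ge yprev_nincr (cvgP _ yprev_cvg0) k.+1.
  by rewrite (cvg_lim _ yprev_cvg0).
by rewrite yprevS; have := hp k; lra.
Qed.

Lemma rseq_itv k : 0 < rseq p k < 1.
Proof.
rewrite /rseq divr_gt0 ?yprev_gt0//= ltr_pdivrMr ?yprev_gt0// mul1r.
by have := yprev_gt0 k.+1; rewrite yprevS; lra.
Qed.

Lemma rseq01 k : 0 <= rseq p k <= 1.
Proof. by have := rseq_itv k; lra. Qed.

Lemma onem_rseq k : 1 - rseq p k = yprev p k.+1 / yprev p k.
Proof.
have y0 : yprev p k != 0 by rewrite gt_eqF ?yprev_gt0.
by rewrite yprevS /rseq mulrBl divff.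
Qed.

Lemma prod_onem_rseq m n : (m <= n)%N ->
  \prod_(m <= i < n) (1 - rseq p i) = yprev p n / yprev p m.
Proof.
elim: n => [|n IH]; first by rewrite leqn0 => /eqP ->; rewrite big_geq// divff ?gt_eqF ?yprev_gt0.
rewrite leq_eqVlt => /predU1P[->|]; first by rewrite big_geq// divff ?gt_eqF ?yprev_gt0.
rewrite ltnS => mn; rewrite big_nat_recr//= IH// onem_rseq.
have y0 : yprev p n != 0 by rewrite gt_eqF ?yprev_gt0.
by rewrite mulrC mulrA divfK.
Qed.

(** Each r_i is at most - ln (1 - r_i) = ln y_(i-1) - ln y_i, and these differences telescope. *)
Lemma sum_rseq_le m n : (m <= n)%N ->
  \sum_(m <= i < n) rseq p i <= ln (yprev p m) - ln (yprev p n).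
Proof.
elim: n => [|n IH]; first by rewrite leqn0 => /eqP ->; rewrite big_geq// subrr.
rewrite leq_eqVlt => /predU1P[->|]; first by rewrite big_geq// subrr.
rewrite ltnS => mn; rewrite big_nat_recr//=.
have : rseq p n <= ln (yprev p n) - ln (yprev p n.+1).
  rewrite -ln_div ?posrE ?yprev_gt0// -[X in X <= _]opprK lerNl -lnV ?posrE ?divr_gt0 ?yprev_gt0//.
  rewrite invf_div -onem_rseq; apply: le_trans (le_ln1Dx _) _.
    by have := rseq_itv n; lra.
  by [].
by move=> h; apply: le_trans (lerD (IH mn) h) _; lra.
Qed.

Section threshold.
Variable t : R.
Hypothesis t1 : 1 <= t.
Let t0 : 0 < t. Proof. exact: lt_le_trans t1. Qed.

Lemma mthr_ex : exists j, ytail p j < t^-1.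
Proof.
have ti : 0 < t^-1 by rewrite invr_gt0.
move/cvgrPdist_lt : yprev_cvg0 => /(_ _ ti) [N _ /(_ N.+1 (leqnSn _))] /=.
by rewrite sub0r normrN => /(le_lt_trans (ler_norm _)) h; exists N.
Qed.

Lemma mthr_lt : yprev p (mthr p t).+1 < t^-1.
Proof.
rewrite /mthr; case: pselect => [h|]; last by have := mthr_ex.
by case: ex_minnP.
Qed.

(** By minimality of m(t); when m(t) = 0 the bound compares t >= 1 with the convention y_(-1) =
    1. *)
Lemma mthr_ge : t^-1 <= yprev p (mthr p t).
Proof.
case E : (mthr p t) => [|j] /=; first by rewrite invf_le1.
move: E; rewrite /mthr; case: pselect => [h|]; last by have := mthr_ex.
case: ex_minnP => m _ hm mE; rewrite leNgt; apply/negP => /hm.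
by rewrite mE ltnn.
Qed.

End threshold.

Lemma mthr_homo (t t' : R) : 1 <= t -> t <= t' -> (mthr p t <= mthr p t')%N.
Proof.
move=> t1 tt'; rewrite leqNgt; apply/negP => h.
have t'1 := le_trans t1 tt'.
have := mthr_ge t1; have := mthr_lt t'1; have := yprev_nincr h.
have : t'^-1 <= t^-1 by rewrite lef_pV2// ?posrE; lra.
lra.
Qed.

End tail_sequence.

(** * Records and delta-records along a trajectory *)

Section record_values.
Context {T : Type} (X : nat -> T -> nat).

Definition xs w n : seq nat := [seq X i w | i <- iota 1 n].

Lemma size_xs w n : size (xs w n) = n.
Proof. by rewrite size_map size_iota. Qed.

Lemma xsS w n : xs w n.+1 = rcons (xs w n) (X n.+1 w).
Proof. by rewrite /xs -(addn1 n) iotaD map_cat cats1 add1n addn1. Qed.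

Lemma all_xs w n (Q : pred nat) : all Q (xs w n) <-> forall i, (1 <= i <= n)%N -> Q (X i w).
Proof.
rewrite all_map; split => [/allP H i ilen|H].
  by apply: (H i); rewrite mem_iota; lia.
by apply/allP => i; rewrite mem_iota => ilen; apply: H; lia.
Qed.

Definition is_record_at w n j := [&& (1 <= n)%N, X n w == j & all (fun x => (x < j)%N) (xs w n.-1)].

(** Decided classically, since it looks at the whole trajectory; [record_before] is the version that
    can be read off the first n observations. *)
Definition record w (j : nat) : bool := `[< exists n, is_record_at w n j >].

Definition record_before w n (j : nat) : bool := has (fun i => is_record_at w i j) (iota 1 n).

Lemma is_record_atP w n j : reflect ((1 <= n)%N /\ X n w = j /\ forall i, (1 <= i < n)%N -> (X i w < j)%N)
  (is_record_at w n j).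
Proof.
apply: (iffP and3P) => [[n1 /eqP Xn /all_xs H]|[n1 [Xn H]]]; split => //.
- by split=> // i ilen; apply: H; lia.
- exact/eqP.
by apply/all_xs => i ilen; apply: H; lia.
Qed.

(** At the first time n when the sequence reaches k, every later record exceeds X_n >= k. So k is a
    record value only if X_n = k, and the records below k are already settled. *)
Lemma record_first_passage w n k : (1 <= n)%N -> (k <= X n w)%N ->
  all (fun x => (x < k)%N) (xs w n.-1) ->
  record w k = (X n w == k) /\ forall j, (j < k)%N -> record w j = record_before w n.-1 j.
Proof.
move=> n1 kX /all_xs lt_k; split.
  apply/asboolP/eqP => [[m /is_record_atP[m1 [Xm lt_m]]]|Xn].
    have [mn|nm|<- //] := ltngtP m n.
      by have := lt_k m ltac:(lia); rewrite Xm ltnn.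
    by have := lt_m n ltac:(lia); lia.
  by exists n; apply/is_record_atP; split => //; split => // i ilt; apply: lt_k; lia.
move=> j jk; apply/asboolP/hasP => [[m /[dup] mr /is_record_atP[m1 [Xm lt_m]]]|[m _ mr]]; last by exists m.
exists m => //; rewrite mem_iota.
have [mn|nm|mn] := ltngtP m n; first by lia.
  by have := lt_m n ltac:(lia); lia.
by move: Xm; rewrite mn; lia.
Qed.

(** Stated for a positive bound because the maximum of no observations is 0, which is not below 0
    although the empty list passes the test. *)
Lemma Mmax_ltP w n k : (Mmax X n w < k.+1)%N <-> all (fun x => (x < k.+1)%N) (xs w n).
Proof.
rewrite all_xs ltnS /Mmax; split => [/bigmax_leqP_seq H i ilen|H].
  by rewrite ltnS; apply: H => //; rewrite mem_index_iota; lia.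
by apply/bigmax_leqP_seq => i; rewrite mem_index_iota => ilen _; apply: H; lia.
Qed.

Lemma MmaxS w n : Mmax X n.+1 w = maxn (Mmax X n w) (X n.+1 w).
Proof. by rewrite /Mmax big_nat_recr. Qed.

Lemma le_Mmax w n i : (1 <= i <= n)%N -> (X i w <= Mmax X n w)%N.
Proof.
move=> ilen; rewrite /Mmax.
by apply: (@leq_bigmax_seq _ _ xpredT (fun i => X i w)) => //; rewrite mem_index_iota; lia.
Qed.

Lemma record_Mmax w n : (1 <= n)%N -> record w (Mmax X n w).
Proof.
case: n => // n _; elim: n => [|n IH].
  apply/asboolP; exists 1%N; apply/is_record_atP; split => //; split; last by lia.
  by rewrite /Mmax big_nat1.
rewrite MmaxS; case: (leqP (X n.+2 w) (Mmax X n.+1 w)) => h //.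
apply/asboolP; exists n.+2; apply/is_record_atP; split=> //; split => // i ilt.
by apply: leq_ltn_trans h; apply: le_Mmax; lia.
Qed.

Lemma record_gap w n j : (Mmax X n w < j < X n.+1 w)%N -> record w j = false.
Proof.
move=> /andP[Mj jX]; apply/asboolP => -[m /is_record_atP[m1 [Xm lt_m]]].
have [mn|nm] := leqP m n; first by have := @le_Mmax w n m ltac:(lia); lia.
have [E|mn] := eqVneq m n.+1; first by move: Xm; rewrite E; lia.
by have := lt_m n.+1 ltac:(lia); lia.
Qed.

(** When x exceeds the current maximum M, it becomes a record value; M is one, and no value strictly
    between is. Hence x - delta, ..., x - 1 are free of record values exactly when M + delta < x. *)
Lemma NrecE delta n w : (1 <= n)%N ->
  Nrec X delta n w = Usum delta (Mmax X n w).+1 (record w).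
Proof.
have step n' : Nrec X delta n'.+1 w = (Nrec X delta n' w + (Mmax X n' w + delta < X n'.+1 w))%N.
  by rewrite /Nrec big_nat_recr.
have zero j : record w j = false -> drec delta (record w) j = false.
  by rewrite /drec => ->; rewrite andbF.
have widen a b : (a <= b)%N -> (forall j, (a <= j < b)%N -> record w j = false) ->
    Usum delta b (record w) = Usum delta a (record w).
  move=> ab H; rewrite /Usum -!(big_mkord xpredT (fun j => nat_of_bool (drec delta (record w) j))).
  rewrite (@big_cat_nat _ _ _ a) //= [X in (_ + X)%N]big1_seq ?addn0// => j.
  by rewrite mem_index_iota /= => /H/zero ->.
case: n => // n _; elim: n => [|n IH].
  (* For a single observation no value below X_1 is a record, so only the clause delta < X_1
     remains, in agreement with M_0 = 0. *)
  rewrite step /Nrec big_geq// add0n /Mmax big_geq// big_nat1 add0n.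
  have r1 : record w (X 1%N w) by have := @record_Mmax w 1 isT; rewrite /Mmax big_nat1.
  have gap j : (j < X 1%N w)%N -> record w j = false.
    move=> jX; apply/asboolP => -[m /is_record_atP[m1 [Xm lt_m]]].
    have [E|m2] := eqVneq m 1%N; first by move: Xm; rewrite E; lia.
    by have := lt_m 1%N ltac:(lia); lia.
  rewrite /Usum big_ord_recr /= big1 ?add0n.
    congr nat_of_bool; rewrite /drec r1 /=; apply/idP/andP => [h|[]//]; split => //.
    by apply/allP => j; rewrite mem_index_iota => jX; rewrite gap//; lia.
  by move=> j _; rewrite zero// gap.
rewrite step IH (MmaxS w n.+1); set M := Mmax X n.+1 w; set x := X n.+2 w.
have [xM|Mx] := leqP x M.
  have -> : (M + delta < x)%N = false by lia.
  by rewrite addn0.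
have rx : record w x.
  by have := @record_Mmax w n.+2 isT; rewrite (MmaxS w n.+1) -/M -/x (maxn_idPr (ltnW Mx)).
have rM : record w M by exact: record_Mmax.
have gap j : (M < j < x)%N -> record w j = false by exact: record_gap.
rewrite [RHS]/Usum big_ord_recr /= -/(Usum delta x (record w)) (@widen M.+1 x) //.
congr (_ + nat_of_bool _)%N; rewrite /drec rx /=; apply/idP/andP => [h|[h /allP H]].
  split; first by lia.
  by apply/allP => j; rewrite mem_index_iota => jX; rewrite gap//; lia.
rewrite ltnNge; apply/negP => xM.
by have := H M; rewrite mem_index_iota rM => /(_ ltac:(lia)).
Qed.

End record_values.

Lemma bernoulli_ineq (R : realFieldType) (u : R) n : 0 <= u <= 1 -> 1 - n%:R * u <= (1 - u) ^+ n.
Proof.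
move=> u01; elim: n => [|n IH]; first by rewrite mul0r subr0 expr0.
rewrite exprS; have h : (1 - u) * (1 - n%:R * u) <= (1 - u) * (1 - u) ^+ n.
  by rewrite ler_wpM2l//; lra.
apply: le_trans h; rewrite -natr1.
have : 0 <= n%:R * u * u by rewrite !mulr_ge0//; lra.
lra.
Qed.

(** * Joint law of the record indicators *)

Section record_law.
Context (d : measure_display) (T : measurableType d) (R : realType).
Variables (P : probability T R) (X : nat -> T -> nat) (p : nat -> R).
Hypothesis hXmeas : forall i k, measurable [set w | X i w = k].
Hypothesis hp : forall k, 0 < p k.
Hypothesis hlaw : forall i k, (1 <= i)%N -> P [set w | X i w = k] = (p k)%:E.
Hypothesis hindep : forall (n : nat) (k : nat -> nat),
     P [set w | forall i, (1 <= i <= n)%N -> X i w = k i]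
       = (\prod_(1 <= i < n.+1) p (k i))%:E.
Local Notation pr := (pr P).

Lemma pmf_sum : series p @ \oo --> (1 : R).
Proof.
have tA : trivIset setT (fun k => [set w | X 1%N w = k]).
  by apply/trivIsetP => i j _ _ /eqP ij; rewrite -subset0 => w [/= Xi Xj]; apply: ij; rewrite -Xi.
have PT : P (\bigcup_n [set w | X 1%N w = n]) = 1%E.
  rewrite -[RHS](probability_setT P); congr (P _).
  by rewrite -subTset => w _; exists (X 1%N w).
have H : (fun n => (\sum_(0 <= i < n) P [set w | X 1%N w = i])%E) @ \oo --> 1%E.
  by rewrite -PT; exact: (@measure_sigma_additive _ _ _ P _ (hXmeas 1%N) tA).
move: H => /fine_cvg; apply: cvg_trans; apply: near_eq_cvg; near=> n.
rewrite /series /= (eq_bigr (fun i => (p i)%:E)) ?sumEFin// => i _; exact: hlaw.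
Unshelve. all: by end_near. Qed.

Local Notation Y := (yprev p).
Local Notation rr := (rseq p).

Lemma X_discrete i : discrete_measurable (X i).
Proof. exact: hXmeas. Qed.

Lemma xs_discrete n : discrete_measurable (fun w => xs X w n).
Proof. by apply: discrete_measurable_map => i _; exact: X_discrete. Qed.

Lemma xs_measurable n (Q : seq nat -> Prop) : measurable [set w | Q (xs X w n)].
Proof. exact: (discrete_measurable_set Q (xs_discrete n)). Qed.

Lemma pr_xs (s : seq nat) : pr [set w | xs X w (size s) = s] = \prod_(c <- s) p c.
Proof.
have -> : \prod_(c <- s) p c = \prod_(1 <= i < (size s).+1) p (nth 0%N s i.-1).
  by rewrite (big_nth 0%N) big_add1.
rewrite /pr.
rewrite -[RHS]/(fine (\prod_(1 <= i < (size s).+1) p (nth 0%N s i.-1))%:E) -hindep.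
congr (fine (P _)); apply/seteqP; split => w /=.
  move=> E [//|i] /= ilen.
  by rewrite -E (nth_map 0%N) ?size_iota// nth_iota.
move=> H; apply: (@eq_from_nth _ 0%N); rewrite size_xs// => i ilen.
by rewrite (nth_map 0%N) ?size_iota// nth_iota// H//= ilen.
Qed.

(** Interpolates between a fixed prefix (m = 0), where the product law applies directly, and a
    general event on observations below k (empty prefix). *)
Let prefixed (k m : nat) (s : seq nat) (Q : pred (seq nat)) := [set w |
  [&& xs X w (size s) == s, all (fun x => (x < k)%N) (xs X w (size s + m)) & Q (xs X w (size s + m))]].

Let prefixed_measurable k m s Q : measurable (prefixed k m s Q).
Proof.
have mg := discrete_measurable_pair (xs_discrete (size s)) (xs_discrete (size s + m)).
exact: (discrete_measurable_set (fun x => [&& x.1 == s, all (fun x => (x < k)%N) x.2 & Q x.2]) mg).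
Qed.

Let prefixed_rcons k m s Q c :
  prefixed k m.+1 s Q `&` [set w | X (size s).+1 w = c] = prefixed k m (rcons s c) Q.
Proof.
apply/seteqP; split => w; rewrite /prefixed /= size_rcons xsS eqseq_rcons addnS addSn.
  by case=> /and3P[-> -> ->] ->; rewrite eqxx.
by case/and3P=> /andP[-> /eqP ->] -> ->.
Qed.

(** Induction on the number m of free observations: summing over the value of the next one extends
    the prefix. The bound k makes these sums finite, so finite additivity suffices. *)
Lemma pr_next_prefix k m s Q x :
  pr (prefixed k m s Q `&` [set w | X (size s + m).+1 w = x]) = pr (prefixed k m s Q) * p x.
Proof.
elim: m s => [|m IH] s.
  have [H|H] := boolP (all (fun x => (x < k)%N) s && Q s).
    have -> : prefixed k 0 s Q = [set w | xs X w (size s) = s].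
      apply/seteqP; split => w; rewrite /prefixed /= addn0; first by case/and3P => /eqP.
      by move=> E; rewrite E eqxx.
    have -> : [set w | xs X w (size s) = s] `&` [set w | X (size s + 0).+1 w = x] =
      [set w | xs X w (size (rcons s x)) = rcons s x].
      apply/seteqP; split => w; rewrite /= size_rcons xsS addn0; first by case=> -> ->.
      by move=> /eqP; rewrite eqseq_rcons => /andP[/eqP -> /eqP ->].
    by rewrite !pr_xs -cats1 big_cat big_seq1.
  have -> : prefixed k 0 s Q = set0.
    apply/seteqP; split => w //; rewrite /prefixed /= addn0 => /andP[/eqP -> h].
    by rewrite h in H.
  by rewrite set0I /pr measure0 mul0r.
have cut A : measurable A -> A `<=` [set w | (X (size s).+1 w < k)%N] ->
   pr A = \sum_(c < k) pr (A `&` [set w | X (size s).+1 w = c]).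
  by move=> mA Ak; rewrite -pr_level_sum//; congr pr; apply/esym/setIidl.
have sub : prefixed k m.+1 s Q `<=` [set w | (X (size s).+1 w < k)%N].
  by move=> w /and3P[_ /all_xs H _]; apply: H; lia.
rewrite cut; last 2 first.
- by apply: measurableI => //; exact: hXmeas.
- by apply: subset_trans sub; exact: subIsetl.
rewrite [in RHS]cut// mulr_suml; apply: eq_bigr => c _.
rewrite setIAC prefixed_rcons -IH; congr (pr (_ `&` _)).
by rewrite size_rcons addSn addnS.
Qed.

Definition below (k n : nat) (Q : pred (seq nat)) :=
  [set w | all (fun x => (x < k)%N) (xs X w n) && Q (xs X w n)].

Lemma below_measurable k n Q : measurable (below k n Q).
Proof. exact: (xs_measurable n (fun s => all (fun x => (x < k)%N) s && Q s)). Qed.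

Lemma pr_below_next k n Q x :
  pr (below k n Q `&` [set w | X n.+1 w = x]) = pr (below k n Q) * p x.
Proof. exact: (pr_next_prefix k n [::] Q x). Qed.

Lemma pr_below_next_lt k n Q j :
  pr (below k n Q `&` [set w | (X n.+1 w < j)%N]) = pr (below k n Q) * (1 - Y j).
Proof.
rewrite pr_level_sum; [|exact: below_measurable|exact: X_discrete].
rewrite yprevE; last exact: pmf_sum.
by rewrite opprB addrC subrK mulr_sumr; apply: eq_bigr => c _; rewrite pr_below_next.
Qed.

Lemma pr_below_next_ge k n Q :
  pr (below k n Q `&` [set w | (k <= X n.+1 w)%N]) = pr (below k n Q) * Y k.
Proof.
have mX : measurable [set w | (X n.+1 w < k)%N].
  exact: (discrete_measurable_set (fun x => x < k)%N (X_discrete n.+1)).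
have := pr_split P (below_measurable k n Q) mX; rewrite pr_below_next_lt.
rewrite (_ : ~` _ = [set w | (k <= X n.+1 w)%N]); last first.
  by apply/seteqP; split => w /=; rewrite [(k <= _)%N]leqNgt => /negP.
by move=> h; apply: (addrI (pr (below k n Q) * (1 - Y k))); rewrite -h; ring.
Qed.

Lemma pr_all_below k n : pr [set w | all (fun x => (x < k)%N) (xs X w n)] = (1 - Y k) ^+ n.
Proof.
elim: n => [|n IH]; first by rewrite expr0 -(prT P); congr pr; apply/seteqP; split.
have := pr_below_next_lt k n xpredT k; rewrite exprSr -IH.
have -> : below k n xpredT = [set w | all (fun x => (x < k)%N) (xs X w n)].
  by apply/seteqP; split => w; rewrite /below /= andbT.
move=> <-; congr pr; apply/seteqP; split => w; rewrite /setI /mkset xsS all_rcons.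
  by case/andP.
by case=> -> ->.
Qed.

Lemma record_discrete j : discrete_measurable (fun w => record X w j).
Proof.
move=> c.
have mr : measurable [set w | record X w j].
  have -> : [set w | record X w j] = \bigcup_n [set w | is_record_at X w n j].
    by apply/seteqP; split => w; [case/asboolP => n nr; exists n|case=> n _ nr; apply/asboolP; exists n].
  apply: bigcup_measurable => n _.
  have mg := discrete_measurable_pair (X_discrete n) (xs_discrete n.-1).
  exact: (discrete_measurable_set
    (fun x => [&& (1 <= n)%N, x.1 == j & all (fun x => (x < j)%N) x.2]) mg).
case: c => //.
rewrite (_ : [set w | _] = ~` [set w | record X w j]); first exact: measurableC.
by apply/seteqP; split => w /=; [move=> ->|case: record => // /(_ isT)].
Qed.

Definition depends_below n (C : Type) (S : (nat -> bool) -> C) :=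
  forall b b', (forall i, (i < n)%N -> b i = b' i) -> S b = S b'.

Lemma depends_below_discrete n (C : countType) (S : (nat -> bool) -> C) : depends_below n S ->
  discrete_measurable (fun w => S (record X w)).
Proof.
move=> Sn.
have mg := discrete_measurable_map (fun i (_ : i \in iota 0 n) => record_discrete i).
have := discrete_measurable_comp (fun s => S (nth false s)) mg.
rewrite /comp; congr (discrete_measurable _); apply/funext => w; apply: Sn => i ilen.
by rewrite (nth_map 0%N) ?size_iota// nth_iota.
Qed.

Lemma depends_below_measurable n (S : (nat -> bool) -> bool) : depends_below n S ->
  measurable [set w | S (record X w)].
Proof. by move=> Sn; exact: (discrete_measurable_set is_true (depends_below_discrete Sn)). Qed.

Lemma pr_never_pass k : P [set w | forall i, (1 <= i)%N -> (X i w < k)%N] = 0%E.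
Proof.
have mN : measurable [set w | forall i, (1 <= i)%N -> (X i w < k)%N].
  rewrite (_ : [set w | _] = \bigcap_n [set w | all (fun x => (x < k)%N) (xs X w n)]); last first.
    apply/seteqP; split => w /= H; last by move=> i i1; move/all_xs: (H i I); apply; lia.
    by move=> n _; apply/all_xs => i /andP[i1 _]; exact: H.
  by apply: bigcap_measurable => // n _; exact: (xs_measurable n (fun s => all (fun x => (x < k)%N) s)).
rewrite prE//; congr EFin; apply/eqP; rewrite eq_le pr_ge0 andbT.
have Y0 := yprev_gt0 hp pmf_sum k.
have Y1 : Y k <= 1 by have := yprev_nincr hp pmf_sum (leq0n k).
have : (fun n => (1 - Y k) ^+ n) @ \oo --> (0 : R).
  by apply: cvg_expr; rewrite ger0_norm; lra.
move=> H; rewrite -(cvg_lim _ H)//; apply: limr_ge; first exact: (cvgP _ H).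
near=> n; rewrite -pr_all_below; apply: pr_le => //; first exact: (xs_measurable n (fun s => all (fun x => (x < k)%N) s)).
by move=> w Hw; apply/all_xs => i /andP[i1 _]; exact: Hw.
Unshelve. all: by end_near. Qed.

(* Split according to the first time n at which the sequence reaches k: on that event the records
   below k are a function of X_1, ..., X_(n-1), and X_n has the law of X_1 conditioned on [k, oo[. *)
Lemma pr_record_indep k (S : (nat -> bool) -> bool) : depends_below k S ->
  pr [set w | record X w k && S (record X w)] = rr k * pr [set w | S (record X w)].
Proof.
move=> Sk.
have Y0 := yprev_gt0 hp pmf_sum.
(* The event on the records below k, read off the list of the first n observations. *)
pose Q n (s : seq nat) : bool := S (fun j =>
  has (fun i => [&& (1 <= i)%N, nth 0%N s i.-1 == j & all (fun x => (x < j)%N) (take i.-1 s)]) (iota 1 n)).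
have QE n w : Q n (xs X w n) = S (record_before X w n).
  congr S; apply/funext => j; apply: eq_in_has => i; rewrite mem_iota => ilen.
  rewrite /is_record_at (nth_map 0%N) ?size_iota; last by lia.
  rewrite nth_iota; last by lia.
  have -> : (1 + i.-1 = i)%N by lia.
  by rewrite /xs -map_take take_iota (_ : minn i.-1 n = i.-1)//; lia.
pose A n := below k n (Q n) `&` [set w | X n.+1 w = k].
pose B n := below k n (Q n) `&` [set w | (k <= X n.+1 w)%N].
have first_pass n w : all (fun x => (x < k)%N) (xs X w n) -> (k <= X n.+1 w)%N ->
    record X w k = (X n.+1 w == k) /\ S (record X w) = Q n (xs X w n).
  move=> h1 h2; have [h3 h4] := @record_first_passage _ X w n.+1 k isT h2 h1.
  by rewrite QE; split => //; apply: Sk => j jk; rewrite h4.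
have mA n : measurable (A n) by apply: measurableI; [exact: below_measurable|exact: hXmeas].
have mB n : measurable (B n).
  apply: measurableI; first exact: below_measurable.
  exact: (discrete_measurable_set (fun x => k <= x)%N (X_discrete n.+1)).
have tB : trivIset setT B.
  apply/trivIsetP => i j _ _; wlog ij : i j / (i < j)%N.
    move=> H; rewrite neq_ltn => /orP[h|h]; first by apply: H => //; rewrite neq_ltn h.
    by rewrite setIC; apply: H => //; rewrite neq_ltn h.
  move=> _; rewrite -subset0 => w [[_ /= kX] [/andP[/all_xs H _] _]].
  by have := H i.+1 ltac:(lia); rewrite ltnNge kX.
have AB n : A n `<=` B n by move=> w [h /= E]; split => //=; rewrite E.
have tA : trivIset setT A.
  apply/trivIsetP => i j _ _ ij; have /trivIsetP/(_ i j I I ij) := tB.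
  by rewrite -!subset0 => H w [/AB Bi /AB Bj]; exact: (H w).
have SA : [set w | record X w k && S (record X w)] = \bigcup_n A n.
  apply/seteqP; split => w.
    move=> /= /andP[kr Sr]; have := kr => /asboolP[[|n] /is_record_atP[// _ [Xn lt_n]]].
    have h : all (fun x => (x < k)%N) (xs X w n) by apply/all_xs => i ilen; apply: lt_n; lia.
    exists n => //; split => //; rewrite /below /mkset h /=.
    by have [_ <-] := first_pass n w h ltac:(lia).
  case=> n _ [/= /andP[h q] Xn].
  by have [-> ->] := first_pass n w h ltac:(lia); rewrite Xn eqxx.
have SB : [set w | S (record X w)] `<=` \bigcup_n B n `|` [set w | forall i, (1 <= i)%N -> (X i w < k)%N].
  move=> w /= Sr; have [H|/existsNP H] := pselect (forall i, (1 <= i)%N -> (X i w < k)%N); first by right.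
  left; have ex : exists i, (1 <= i)%N && (k <= X i w)%N.
    by case: H => i /not_implyP[i1 /negP]; rewrite -leqNgt => ki; exists i; rewrite i1.
  case: (ex_minnP ex) => -[//|n] /= kX nmin.
  have h : all (fun x => (x < k)%N) (xs X w n).
    apply/all_xs => i /andP[i1 ilen]; rewrite ltnNge; apply/negP => kXi.
    by have := nmin i; rewrite i1 kXi /= => /(_ isT); lia.
  exists n => //; split => //; rewrite /below /mkset h /=.
  by have [_ <-] := first_pass n w h kX.
have BS : \bigcup_n B n `<=` [set w | S (record X w)].
  by move=> w [n _ [/= /andP[h q] kX]]; have [_ ->] := first_pass n w h kX.
have mS := depends_below_measurable Sk.
have mUB : measurable (\bigcup_n B n) by apply: bigcup_measurable.
(* The B n exhaust the event up to the trajectories that never reach k, a null set. *)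
have PS : pr [set w | S (record X w)] = pr (\bigcup_n B n).
  apply/eqP; rewrite eq_le; apply/andP; split; last exact: pr_le.
  have mN : measurable [set w | forall i, (1 <= i)%N -> (X i w < k)%N].
    rewrite (_ : [set w | _] = \bigcap_n [set w | all (fun x => (x < k)%N) (xs X w n)]); last first.
      apply/seteqP; split => w /= H; last by move=> i i1; move/all_xs: (H i I); apply; lia.
      by move=> n _; apply/all_xs => i /andP[i1 _]; exact: H.
    by apply: bigcap_measurable => // n _; exact: (xs_measurable n (fun s => all (fun x => (x < k)%N) s)).
  have N0 : pr [set w | forall i, (1 <= i)%N -> (X i w < k)%N] = 0.
    by rewrite /pr pr_never_pass.
  rewrite -[leRHS]addr0 -N0; apply: le_trans (prU_le P mUB mN).
  by apply: pr_le => //; exact: measurableU.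
apply: EFin_inj; rewrite EFinM -!prE//; last first.
  by rewrite SA; apply: bigcup_measurable.
rewrite (prE P mS) PS -(prE P mUB) SA !measure_bigcup//.
rewrite -nneseriesZl//.
apply: eq_eseriesr => n _.
suff H : (P (A n) = (rr k)%:E * P (B n))%E by exact: H.
rewrite !prE// -EFinM; congr EFin.
(* Term by term the ratio is p_k / y_(k-1) = r_k, so neither series has to be evaluated. *)
rewrite /A /B pr_below_next pr_below_next_ge /rseq.
have y0 : Y k != 0 by rewrite gt_eqF.
by move: (pr _) (p k) (Y k) y0 => u v y y0; field.
Qed.

(** Induction on n: split according to whether n is a record value, freeze coordinate n on each
    half, and use its independence from the coordinates below. *)
Lemma pr_record_law n (S : (nat -> bool) -> bool) b0 : depends_below n S ->
  pr [set w | S (record X w)] = Ex rr n (fun b => (S b)%:R) b0.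
Proof.
elim: n S => [|n IH] S Sn /=.
  rewrite (_ : [set w | _] = if S b0 then setT else set0); last first.
    apply/seteqP; split => w /=; rewrite (Sn _ b0)//; first by move=> ->.
    by case: ifP.
  by case: ifP; rewrite ?prT ?pr0.
pose S' x b := S (upd b n x).
have S'n x : depends_below n (S' x).
  move=> b b' bb'; apply: Sn => i; rewrite ltnS leq_eqVlt /upd => /predU1P[->|ilt].
    by rewrite eqxx.
  by case: eqP => // _; exact: bb'.
have updE w x : record X w n = x -> upd (record X w) n x = record X w.
  by move=> <-; apply/funext => j; rewrite /upd; case: eqP => // ->.
have mS := depends_below_measurable Sn.
have mS' x := depends_below_measurable (S'n x).
have mr : measurable [set w | record X w n] by exact: (discrete_measurable_set is_true (record_discrete n)).
rewrite (pr_split P mS mr).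
have -> : [set w | S (record X w)] `&` [set w | record X w n] =
    [set w | record X w n && S' true (record X w)].
  apply/seteqP; split => w /=.
    by case=> Sw rw; rewrite rw /S' updE.
  by case/andP => rw; rewrite /S' updE.
have -> : [set w | S (record X w)] `&` ~` [set w | record X w n] =
    [set w | S' false (record X w)] `&` ~` [set w | record X w n].
  apply/seteqP; split => w /= [Sw /negP/negbTE rw]; split; rewrite ?rw//.
    by rewrite /S' updE.
  by move: Sw; rewrite /S' updE.
have := pr_split P (mS' false) mr.
have -> : [set w | S' false (record X w)] `&` [set w | record X w n] =
    [set w | record X w n && S' false (record X w)].
  by apply/seteqP; split => w /=; [case=> -> ->|case/andP].
rewrite !pr_record_indep// => h.
have {h} -> : pr ([set w | S' false (record X w)] `&` ~` [set w | record X w n]) =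
   (1 - rr n) * pr [set w | S' false (record X w)].
  by apply: (addrI (rr n * pr [set w | S' false (record X w)])); rewrite -h; ring.
have -> : avg rr n (fun b => (S b)%:R) =
    (fun b => rr n * (S' true b)%:R + ((1 - rr n) * (S' false b)%:R + 0)).
  by apply/funext => b; rewrite addr0.
by rewrite !Ex_lin Ex_0 addr0 -!IH.
Qed.

End record_law.

(** * Variance asymptotics *)

Section local_variance_asymptotics.
Variables (R : realType) (rr : nat -> R) (delta : nat).
Hypothesis rr01 : forall i, 0 <= rr i <= 1.
Local Notation q := (qrec rr delta).

(** Summand of [Uvar] with the window around i not cut at the range K; being independent of K, it
    can be compared termwise with a fixed sequence. *)
Definition local_var i : R :=
  q i * (1 - \sum_(j < i + delta.+1 | near_idx delta i j) q j).

Let q0 := qrec_ge0 rr01 delta.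
Let q1 := qrec_le1 rr01 delta.

Let near_sum_itv K i : 0 <= \sum_(j < K | near_idx delta i j) q j <= (delta.*2.+1)%:R.
Proof.
apply/andP; split; first exact: sumr_ge0.
apply: (@le_trans _ _ (\sum_(j < K | near_idx delta i j) 1)); first exact: ler_sum.
by rewrite sumr_const ler_nat near_idx_card.
Qed.

(** Only the windows of indices near K are cut: at most 2 delta + 1 of them, each at a cost of at
    most 2 delta + 1. *)
Lemma Uvar_local_var K :
  `|Uvar rr delta K - \sum_(i < K) local_var i| <= (delta.*2.+1)%:R ^+ 2.
Proof.
rewrite /Uvar -sumrB; apply: le_trans (ler_norm_sum _ _ _) _.
pose D : R := (delta.*2.+1)%:R.
apply: (@le_trans _ _ (\sum_(i < K) if near_idx delta K i then D else 0)).
  apply: ler_sum => i _; rewrite /local_var -mulrBr.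
  case: ifP => H.
    rewrite normrM (ger0_norm (q0 i)) -[leRHS]mul1r; apply: ler_pM => //.
    have := near_sum_itv K i; have := near_sum_itv (i + delta.+1) i.
    by rewrite -/D ler_norml; lra.
  have iK : (i + delta.+1 <= K)%N.
    by move: H; rewrite /near_idx; have := ltn_ord i; lia.
  have -> : \sum_(j < i + delta.+1 | near_idx delta i j) q j = \sum_(j < K | near_idx delta i j) q j.
    rewrite (big_ord_widen_cond _ (fun j => near_idx delta i j) (fun j => q j) iK).
    by apply: eq_bigl => j; rewrite /near_idx; lia.
  by rewrite subrr mulr0 normr0.
rewrite -big_mkcond /= sumr_const -[leLHS]mulr_natl -/D expr2 ler_wpM2r ?ler0n// ler_nat.
exact: near_idx_card.
Qed.

(** The finitely many indices where the comparison fails go into C, uniformly in K. *)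
Lemma Uvar_asymp (b : nat -> R) (L eps : R) : (forall j, 0 <= b j) ->
  (exists N, forall j, (N <= j)%N -> `|local_var j - L * b j| <= eps * b j) -> 0 <= eps ->
  exists C, forall K, `|Uvar rr delta K - L * \sum_(j < K) b j| <= eps * \sum_(j < K) b j + C.
Proof.
move=> b0 [N HN] eps0.
pose c j := `|local_var j - L * b j|.
exists (\sum_(j < N) c j + (delta.*2.+1)%:R ^+ 2) => K.
have -> : Uvar rr delta K - L * \sum_(j < K) b j =
   (Uvar rr delta K - \sum_(i < K) local_var i) + \sum_(j < K) (local_var j - L * b j).
  by rewrite sumrB mulr_sumr; ring.
apply: le_trans (ler_normD _ _) _; rewrite [leLHS]addrC [leRHS]addrA; apply: lerD; last exact: Uvar_local_var.
apply: le_trans (ler_norm_sum _ _ _) _.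
apply: (@le_trans _ _ (\sum_(j < K) (eps * b j + if (j < N)%N then c j else 0))).
  apply: ler_sum => j _; case: ltnP => [jN|/HN]; last by rewrite addr0.
  by rewrite lerDr mulr_ge0.
rewrite big_split /= -mulr_sumr lerD2l -big_mkcond.
have [KN|NK] := leqP K N.
  apply: (@le_trans _ _ (\sum_(j < K) c j)).
    by rewrite big_mkcond; apply: ler_sum => j _; case: ifP => // _; exact: normr_ge0.
  rewrite (big_ord_widen _ c KN) big_mkcond /=; apply: ler_sum => j _.
  by case: ifP => // _; exact: normr_ge0.
by rewrite (big_ord_widen _ c (ltnW NK)).
Qed.

End local_variance_asymptotics.

Lemma cvg_sum_ord (R : realType) n (u : nat -> nat -> R) (l : R) :
  (forall i, (i < n)%N -> u i @ \oo --> l) ->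
  (fun k => \sum_(i < n) u i k) @ \oo --> n%:R * l.
Proof.
elim: n => [|n IH] H.
  by rewrite mul0r; under eq_fun do rewrite big_ord0; exact: cvg_cst.
under eq_fun do rewrite big_ord_recr /=.
by rewrite -natr1 mulrDl mul1r; apply: cvgD; [apply: IH => i ilen; apply: H; exact: ltnW|exact: H].
Qed.

Lemma cvg_prod_ord (R : realType) n (u : nat -> nat -> R) (l : R) :
  (forall i, (i < n)%N -> u i @ \oo --> l) ->
  (fun k => \prod_(i < n) u i k) @ \oo --> l ^+ n.
Proof.
elim: n => [|n IH] H.
  by rewrite expr0; under eq_fun do rewrite big_ord0; exact: cvg_cst.
under eq_fun do rewrite big_ord_recr /=.
by rewrite exprSr; apply: cvgM; [apply: IH => i ilen; apply: H; exact: ltnW|exact: H].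
Qed.

Section local_variance_limits.
Variables (R : realType) (rr : nat -> R) (delta : nat) (r : R).
Hypothesis rr01 : forall i, 0 < rr i < 1.
Hypothesis hr : rr @ \oo --> r.
Local Notation q := (qrec rr delta).
Let Q := r * (1 - r) ^+ delta.

Let rr01w i : 0 <= rr i <= 1. Proof. by have := rr01 i; lra. Qed.

(** Probability that none of j - delta, ..., j - 1 is a record value, that is e_(j - delta) when j >
    delta; the value 0 below mirrors the clause [delta < j] of [drec]. *)
Definition gap_prob j : R := if (delta < j)%N then \prod_(j - delta <= i < j) (1 - rr i) else 0.

Lemma qrecE j : q j = rr j * gap_prob j.
Proof. by rewrite /qrec /gap_prob; case: ifP; rewrite ?mulr0. Qed.

Lemma gap_prob_itv j : 0 <= gap_prob j <= 1.
Proof.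
rewrite /gap_prob; case: ifP => _; last by rewrite lexx ler01.
rewrite prodr_ge0 => [|i _]; last by have := rr01 i; lra.
by apply: prodr_ile1 => i; have := rr01 i; lra.
Qed.

Lemma qrec_le_gap_prob j : q j <= gap_prob j.
Proof.
by rewrite qrecE ler_piMl//; [have := gap_prob_itv j; lra|have := rr01 j; lra].
Qed.

Lemma gap_prob_cvg : gap_prob @ \oo --> (1 - r) ^+ delta.
Proof.
rewrite -(cvg_shiftn delta.+1).
have -> : (fun n => gap_prob (n + delta.+1)) = (fun n => \prod_(i < delta) (1 - rr (n + i.+1))).
  apply/funext => n; rewrite /gap_prob ifT; last by lia.
  have -> : (n + delta.+1 - delta = 0 + n.+1)%N by lia.
  rewrite big_addn (_ : n + delta.+1 - n.+1 = delta)%N; last by lia.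
  by rewrite big_mkord; apply: eq_bigr => i _; rewrite addnC addSnnS.
apply: (@cvg_prod_ord _ _ (fun i n => 1 - rr (n + i.+1))) => i _.
apply: cvgB; first exact: cvg_cst.
by rewrite (cvg_shiftn i.+1 rr).
Qed.

Lemma qrec_cvg : q @ \oo --> Q.
Proof.
have -> : q = (fun j => rr j * gap_prob j) by apply/funext => j; rewrite qrecE.
by apply: cvgM => //; exact: gap_prob_cvg.
Qed.

Lemma near_sum_cvg :
  (fun i => \sum_(j < i + delta.+1 | near_idx delta i j) q j) @ \oo --> (delta.*2.+1)%:R * Q.
Proof.
rewrite -(cvg_shiftn delta).
have -> : (fun n => \sum_(j < n + delta + delta.+1 | near_idx delta (n + delta) j) q j) =
   (fun n => \sum_(i < delta.*2.+1) q (n + i)).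
  apply/funext => n.
  rewrite -(big_mkord (near_idx delta (n + delta)) q) (@big_cat_nat _ _ _ n)//=; last by lia.
  rewrite big_nat_cond big1 ?add0r; last by move=> i; rewrite /near_idx; lia.
  rewrite big_nat_cond (eq_bigl (fun i => (n <= i < n + delta + delta.+1)%N)); last first.
    by move=> i; rewrite /near_idx; lia.
  rewrite -big_nat -[X in \sum_(X <= _ < _) _]add0n big_addn big_mkord.
  rewrite (_ : n + delta + delta.+1 - n = delta.*2.+1)%N; last by lia.
  by apply: eq_bigr => i _; rewrite addnC.
apply: (@cvg_sum_ord _ _ (fun i n => q (n + i))) => i _.
by rewrite (cvg_shiftn i q); exact: qrec_cvg.
Qed.

Definition hazard j : R := - ln (1 - rr j).

Lemma le_hazard j : rr j <= hazard j.
Proof.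
rewrite /hazard lerNr; apply: (@le_trans _ _ (ln (1 + - rr j))); first by [].
by apply: le_ln1Dx; have := rr01 j; lra.
Qed.

Lemma hazard_gt0 j : 0 < hazard j.
Proof. by apply: lt_le_trans (le_hazard j); have /andP[] := rr01 j. Qed.

Lemma hazard_le j : hazard j * (1 - rr j) <= rr j.
Proof.
have y0 : 0 < 1 - rr j by have := rr01 j; lra.
rewrite -ler_pdivlMr// /hazard -lnV ?posrE//.
have E : (1 - rr j)^-1 = 1 + rr j / (1 - rr j) by field; rewrite gt_eqF.
rewrite [X in ln X]E.
by apply: le_ln1Dx; apply: lt_trans (divr_gt0 _ y0); have := rr01 j; lra.
Qed.

(** For r = 0 both terms vanish in the limit, and the ratio is squeezed between 1 - r_j and 1. *)
Lemma hazard_ratio_cvg : r < 1 ->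
  (fun j => rr j / hazard j) @ \oo --> if r == 0 then 1 else - r / ln (1 - r).
Proof.
move=> r1; have [r0|r0] := eqVneq r 0.
  have h1 : (fun j => 1 - rr j) @ \oo --> (1 : R).
    by rewrite -[X in _ --> X]subr0 -r0; apply: cvgB => //; exact: cvg_cst.
  apply: (@squeeze_cvgr _ _ _ _ (fun j => 1 - rr j) (fun=> 1)) => //; last exact: cvg_cst.
  near=> j.
  rewrite ler_pdivlMr ?hazard_gt0// mulrC hazard_le /=.
  by rewrite ler_pdivrMr ?hazard_gt0// mul1r le_hazard.
have lr : - ln (1 - r) != 0.
  have rge0 : 0 <= r.
    rewrite -(cvg_lim _ hr)//; apply: limr_ge; first exact: (cvgP _ hr).
    by near=> j; have := rr01 j; lra.
  have rgt0 : 0 < r by rewrite lt_neqAle eq_sym r0.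
  rewrite oppr_eq0 lt_eqF//; apply: le_lt_trans (le_ln1Dx _) _; lra.
have -> : - r / ln (1 - r) = r * (- ln (1 - r))^-1 by rewrite invrN mulrN mulNr.
apply: cvgM => //; apply: cvgV => //.
apply: cvgN; apply: continuous_cvg; first by apply: continuous_ln; lra.
by apply: cvgB => //; exact: cvg_cst.
Unshelve. all: by end_near. Qed.

End local_variance_limits.

Lemma natr_doubleS (R : pzRingType) n : (n.*2.+1)%:R = 2 * n%:R + 1 :> R.
Proof. by rewrite -natr1 -muln2 natrM mulr_natr mulr_natl. Qed.

Lemma pow1p_ge (R : realFieldType) (x : R) n : 0 <= x ->
  1 + n%:R * x + n%:R * (n%:R - 1) / 2 * x ^+ 2 <= (1 + x) ^+ n.
Proof.
move=> x0; elim: n => [|n IH]; first by rewrite expr0; lra.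
rewrite (exprS (1 + x)); have h := ler_wpM2l (addr_ge0 ler01 x0) IH.
apply: le_trans h; rewrite -natr1.
have [->|n1] := posnP n; first by lra.
have n1R : 1 <= n%:R :> R by rewrite ler1n.
have : 0 <= n%:R * (n%:R - 1) / 2 * x ^+ 3 by rewrite !mulr_ge0 ?exprn_ge0//; lra.
lra.
Qed.

(* Makes the limiting variance positive: with x = r / (1 - r), the second-order Bernoulli inequality
   reduces the claim to 1 - n x + n^2 x^2 / 2 > 0. *)
Lemma geometric_pmf_lt (R : realFieldType) (r : R) n : 0 <= r < 1 ->
  (n.*2.+1)%:R * (r * (1 - r) ^+ n) < 1.
Proof.
move=> r01; have u0 : 0 < 1 - r by lra.
pose x := r / (1 - r).
have x0 : 0 <= x by rewrite divr_ge0; lra.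
have xE : 1 + x = (1 - r)^-1 by rewrite /x; field; rewrite gt_eqF.
have rE : r = x / (1 + x).
  by rewrite xE invrK /x divfK ?gt_eqF.
have p0 : 0 < (1 - r) ^+ n by rewrite exprn_gt0.
have H := pow1p_ge n x0.
rewrite xE exprVn in H.
rewrite mulrA -ltr_pdivlMr// mul1r; apply: lt_le_trans H.
rewrite {1}rE mulrA ltr_pdivrMr; last by lra.
rewrite natr_doubleS.
clear xE rE; clearbody x.
have [->|n0] := posnP n; first by lra.
have a1 : 1 <= n%:R :> R by rewrite ler1n.
move: (n%:R : R) a1 => a a1.
have : 0 <= a * x * x by rewrite !mulr_ge0//; lra.
have : 0 <= a * (a - 1) * x ^+ 3 by rewrite !mulr_ge0 ?exprn_ge0//; lra.
have := sqr_ge0 (a * x - 1).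
lra.
Qed.

Lemma sigma2_gt0 (R : realType) (delta : nat) (r : R) : 0 <= r < 1 -> 0 < sigma2 delta r.
Proof.
move=> r01; rewrite /sigma2; case: eqVneq => // r0.
have u0 : 0 < 1 - r by lra.
have l0 : ln (1 - r) < 0 by apply: le_lt_trans (le_ln1Dx _) _; lra.
have H := geometric_pmf_lt delta r01.
(* The bracket in [sigma2] equals 1 - (2 delta + 1) r (1 - r)^delta, the limit of one minus the sum
   of the neighbouring q_j. *)
have -> : - r * (1 - r) ^+ delta
       * ((1 - r) ^+ delta.+1 - (1 + 2 * delta%:R * r) * (1 - r) ^+ delta + 1)
       / ln (1 - r) = r * (1 - r) ^+ delta * (1 - (delta.*2.+1)%:R * (r * (1 - r) ^+ delta)) / - ln (1 - r).
  rewrite exprS natr_doubleS; field; rewrite lt_eqF//=; lra.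
rewrite divr_gt0 ?oppr_gt0// mulr_gt0 ?subr_gt0// mulr_gt0 ?exprn_gt0//.
by rewrite lt_neqAle eq_sym r0; lra.
Qed.

Section local_variance_comparison.
Variables (R : realType) (rr : nat -> R) (delta : nat) (r : R).
Hypothesis rr01 : forall i, 0 < rr i < 1.
Hypothesis hr : rr @ \oo --> r.
Local Notation near_sum i := (\sum_(j < i + delta.+1 | near_idx delta i j) qrec rr delta j).

Lemma local_var_compare (b g : nat -> R) (L : R) : (forall j, 0 <= b j) ->
  (forall j, local_var rr delta j = b j * g j) -> g @ \oo --> L ->
  forall eps, 0 < eps ->
  exists N, forall j, (N <= j)%N -> `|local_var rr delta j - L * b j| <= eps * b j.
Proof.
move=> b0 E gL eps eps0.
move/cvgrPdist_le : gL => /(_ _ eps0)[N _ HN]; exists N => j /HN /= H.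
by rewrite E (mulrC L) -mulrBr normrM (ger0_norm (b0 j)) mulrC ler_wpM2r// distrC.
Qed.

(** Divided by the hazard, the local variance is a product of three convergent factors: r_j over the
    hazard, the gap probability, and one minus the neighbour sum. The product of their limits is
    [sigma2]. *)
Lemma local_var_hazard : 0 <= r < 1 -> forall eps, 0 < eps ->
  exists N, forall j, (N <= j)%N ->
    `|local_var rr delta j - sigma2 delta r * hazard rr j| <= eps * hazard rr j.
Proof.
move=> r01; apply: (@local_var_compare _ (fun j => rr j / hazard rr j * gap_prob rr delta j * (1 - near_sum j))).
- by move=> j; exact: ltW (hazard_gt0 rr01 j).
- move=> j; rewrite /local_var qrecE mulrA mulrA [hazard rr j * _]mulrC divfK//.
  by rewrite gt_eqF// hazard_gt0.
have -> : sigma2 delta r = (if r == 0 then 1 else - r / ln (1 - r)) * (1 - r) ^+ delta *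
    (1 - (delta.*2.+1)%:R * (r * (1 - r) ^+ delta)).
  rewrite /sigma2; case: eqVneq => [->|r0].
    by rewrite subr0 expr1n !mul0r mulr0 subr0 !mulr1.
  have l0 : ln (1 - r) < 0.
    apply: le_lt_trans (le_ln1Dx _) _; first by lra.
    by rewrite oppr_lt0 lt_neqAle eq_sym r0; lra.
  rewrite exprS natr_doubleS; field; by rewrite lt_eqF.
apply: cvgM.
  apply: cvgM; last exact: gap_prob_cvg.
  apply: (hazard_ratio_cvg rr01 hr); lra.
apply: cvgB; first exact: cvg_cst.
exact: near_sum_cvg.
Qed.

(** At r = 1 the neighbour sum tends to a multiple of 0^delta, which vanishes because delta > 0. *)
Lemma local_var_gap : (0 < delta)%N -> r = 1 -> forall eps, 0 < eps ->
  exists N, forall j, (N <= j)%N ->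
    `|local_var rr delta j - 1 * gap_prob rr delta j| <= eps * gap_prob rr delta j.
Proof.
move=> d0 r1; apply: (@local_var_compare _ (fun j => rr j * (1 - near_sum j))).
- by move=> j; have /andP[] := gap_prob_itv delta rr01 j.
- by move=> j; rewrite /local_var qrecE mulrA (mulrC (rr j)).
have E : r * (1 - (delta.*2.+1)%:R * (r * (1 - r) ^+ delta)) = 1.
  by rewrite r1 subrr expr0n eqn0Ngt d0 !mulr0 subr0 mulr1.
rewrite -[X in _ --> X]E; apply: cvgM => //.
by apply: cvgB; [exact: cvg_cst|exact: near_sum_cvg].
Qed.

End local_variance_comparison.

(** B_n^2 need only match the comparison sum up to a bounded error, which B_n^2 outgrows. *)
Lemma Uvar_normalized (R : realType) (rr : nat -> R) (delta : nat) (b : nat -> R)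
    (K : nat -> nat) (B : nat -> R) (L C : R) :
  (forall i, 0 < rr i < 1) -> (forall j, 0 <= b j) ->
  (forall eps : R, 0 < eps -> exists N, forall j, (N <= j)%N ->
    `|local_var rr delta j - L * b j| <= eps * b j) ->
  B @ \oo --> +oo ->
  (\forall n \near \oo, `|B n ^+ 2 - \sum_(j < K n) b j| <= C) ->
  (fun n => Uvar rr delta (K n) / B n ^+ 2) @ \oo --> L.
Proof.
move=> rr01 b0 Hb Boo BC; apply/cvgrPdist_le => eps eps0.
have rr01w i : 0 <= rr i <= 1 by have := rr01 i; lra.
have e2 : 0 < eps / 2 by lra.
have [C' HC'] := Uvar_asymp rr01w b0 (Hb _ e2) (ltW e2).
(* All bounded errors together: the constant of [Uvar_asymp] and the mismatch C, weighted by |L| and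
   by eps / 2. They are eventually at most eps / 2 times B_n^2. *)
pose C2 := `|C'| + `|L| * C + eps / 2 * C.
near=> n.
have BCn : `|B n ^+ 2 - \sum_(j < K n) b j| <= C by near: n.
have Bn1 : 1 <= B n by near: n; move/cvgryPge : Boo; exact.
have BnC : C2 / (eps / 2) <= B n by near: n; move/cvgryPge : Boo; exact.
have B2 : 0 < B n ^+ 2 by rewrite exprn_gt0//; lra.
rewrite -[X in `|X - _|](mulfK (x := B n ^+ 2)) ?gt_eqF// -mulrBl normr_div// ler_pdivrMr//.
have H := HC' (K n).
move: (\sum_(j < K n) b j) (Uvar rr delta (K n)) BCn H => beta V BCn H.
have -> : L * B n ^+ 2 - V = L * (B n ^+ 2 - beta) - (V - L * beta) by ring.
apply: le_trans (ler_normB _ _) _; rewrite normrM.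
have H1 : `|L| * `|B n ^+ 2 - beta| <= `|L| * C by rewrite ler_wpM2l.
have H2 : beta <= B n ^+ 2 + C by move: BCn; rewrite ler_norml; lra.
have H3 : eps / 2 * beta <= eps / 2 * (B n ^+ 2 + C) by rewrite ler_pM2l.
have H4 : C2 <= eps / 2 * B n ^+ 2.
  rewrite -ler_pdivrMl// mulrC; apply: le_trans BnC _.
  by rewrite expr2 ler_peMl//; lra.
have := ler_norm C'; rewrite /C2 in H4; lra.
Unshelve. all: by end_near. Qed.

(** * From the deterministic level m(n) to the random level M_n *)

Lemma Usum_depends (delta K : nat) : depends_below K (Usum delta K).
Proof.
move=> b b' bb'; apply: eq_bigr => j _; congr nat_of_bool; rewrite /drec bb'//.
congr [&& _, _ & _]; apply: eq_in_all => i; rewrite mem_index_iota => /andP[_ ij].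
by rewrite bb'//; exact: ltn_trans ij (ltn_ord j).
Qed.

Lemma Usum_homo (delta m n : nat) b : (m <= n)%N -> (Usum delta m b <= Usum delta n b)%N.
Proof.
move=> mn; rewrite /Usum -!(big_mkord xpredT (fun j => nat_of_bool (drec delta b j))).
by rewrite [leqRHS](@big_cat_nat _ _ _ m) //= leq_addr.
Qed.

Lemma Ex_Usum (R : realType) (rr : nat -> R) (delta K n : nat) b0 : (K <= n)%N ->
  Ex rr n (fun b => (Usum delta K b)%:R) b0 = Umean rr delta K.
Proof.
move=> Kn.
have -> : (fun b => (Usum delta K b)%:R) = (fun b => \sum_(j < K) (drec delta b j)%:R : R).
  by apply/funext => b; rewrite /Usum natr_sum.
rewrite (@mean_sum _ _ (fun F => Ex rr n F b0) (fun a F G => Ex_lin rr n a F G b0) (Ex_1 rr n b0)).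
by apply: eq_bigr => j _; rewrite Ex_drec//; exact: leq_trans (ltn_ord j) Kn.
Qed.

Lemma sum_itv_le1 (R : realDomainType) (u : nat -> R) m n : (forall i, 0 <= u i <= 1) ->
  0 <= \sum_(m <= i < m + n) u i <= n%:R.
Proof.
move=> u01; elim: n => [|n IH]; first by rewrite addn0 big_geq// lexx.
by rewrite addnS big_nat_recr ?leq_addr//= -natr1; have := u01 (m + n)%N; lra.
Qed.

(** Used for [theta] against the mean count and for the e_k against [gap_prob]. The shift leaves
    delta terms at the top and the term u 0; the latter belongs to the value delta, which is never a
    delta-record. *)
Lemma shifted_sum_dist (R : realDomainType) (u v : nat -> R) (delta K : nat) :
  (forall i, (0 < i)%N -> u i = v (i + delta)) -> (forall j, (j <= delta)%N -> v j = 0) ->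
  (forall j, 0 <= v j <= 1) -> 0 <= u 0 <= 1 ->
  `|\sum_(i < K.+1) u i - \sum_(j < K.+1) v j| <= (delta.+1)%:R.
Proof.
move=> uv v0 v01 u01.
have -> : \sum_(i < K.+1) u i = u 0 + \sum_(0 <= j < K.+1 + delta) v j.
  rewrite big_ord_recl /=; congr (_ + _).
  rewrite (@big_cat_nat _ _ _ delta.+1)//=; last by lia.
  rewrite [X in _ = X + _]big1_seq ?add0r; last first.
    by move=> i; rewrite mem_index_iota /= => ih; apply: v0; lia.
  rewrite -[X in \sum_(X <= _ < _) _]add0n big_addn big_mkord.
  rewrite (_ : K.+1 + delta - delta.+1 = K)%N; last by lia.
  by apply: eq_bigr => i _; rewrite uv//=; congr v; rewrite /bump; lia.
rewrite -(big_mkord xpredT v) (@big_cat_nat _ _ _ K.+1 0)//= ?leq_addr//.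
have := sum_itv_le1 K.+1 delta v01; rewrite -natr1 ler_norml; lra.
Qed.

Section mean_comparison.
Variables (R : realType) (p : nat -> R) (delta : nat).
Hypotheses (hp : forall k, 0 < p k) (hsum : series p @ \oo --> (1 : R)).
Local Notation rr := (rseq p).
Local Notation q := (qrec rr delta).

Let rr01 i : 0 <= rr i <= 1 := rseq01 hp hsum i.

Lemma sseqE k : sseq p delta k = rr (k + delta) * \prod_(k <= i < k + delta) (1 - rr i).
Proof.
rewrite /sseq prod_onem_rseq ?leq_addr// /rseq.
have := yprev_gt0 hp hsum k; have := yprev_gt0 hp hsum (k + delta).
move: (p _) (yprev p k) (yprev p _) => a u v v0 u0; field.
by rewrite !gt_eqF.
Qed.

Lemma sseq_qrec k : (0 < k)%N -> sseq p delta k = q (k + delta).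
Proof. by move=> k0; rewrite sseqE /qrec ifT ?addnK//; lia. Qed.

Lemma theta_Umean m : `|theta p delta m - Umean rr delta m.+1| <= (delta.+1)%:R.
Proof.
have q01 i : 0 <= q i <= 1 by rewrite qrec_ge0//= qrec_le1.
have s01 : 0 <= sseq p delta 0 <= 1.
  rewrite sseqE mulr_ge0//=; last 2 first.
  - by have /andP[] := rr01 (0 + delta).
  - by apply: prodr_ge0 => i _; have := rr01 i; lra.
  apply: mulr_ile1; first by have /andP[] := rr01 (0 + delta).
  - by apply: prodr_ge0 => i _; have := rr01 i; lra.
  - by have /andP[] := rr01 (0 + delta).
  - by apply: prodr_ile1 => i; have := rr01 i; lra.
apply: shifted_sum_dist => //; first by move=> i; exact: sseq_qrec.
by move=> j jd; rewrite /qrec ltnNge jd.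
Qed.

(** The last index is bounded by 1 apart, so that the logarithm is taken at y_(n-1): for a threshold
    n = m(t) this is bounded below by 1 / t, whereas y_n is not. *)
Lemma sum_qrec_itv_le m n : (m < n)%N ->
  Umean rr delta n.+1 - Umean rr delta m.+1 <= 1 + (ln (yprev p m.+1) - ln (yprev p n)).
Proof.
move=> mn; rewrite /Umean -!(big_mkord xpredT q).
rewrite [X in X - _](@big_cat_nat _ _ _ m.+1)//=; last exact: leqW.
rewrite addrAC subrr add0r big_nat_recr//= addrC; apply: lerD; first exact: qrec_le1.
apply: le_trans (sum_rseq_le hp hsum mn).
by apply: ler_sum => i _; exact: qrec_le.
Qed.

End mean_comparison.

Section record_process.
Context (d : measure_display) (T : measurableType d) (R : realType).
Variables (P : probability T R) (X : nat -> T -> nat) (p : nat -> R).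
Hypothesis hXmeas : forall i k, measurable [set w | X i w = k].
Hypothesis hp : forall k, 0 < p k.
Hypothesis hlaw : forall i k, (1 <= i)%N -> P [set w | X i w = k] = (p k)%:E.
Hypothesis hindep : forall (n : nat) (k : nat -> nat),
     P [set w | forall i, (1 <= i <= n)%N -> X i w = k i]
       = (\prod_(1 <= i < n.+1) p (k i))%:E.
Variable delta : nat.
Local Notation pr := (pr P).
Local Notation Y := (yprev p).
Local Notation rr := (rseq p).
Let hsum := pmf_sum hXmeas hlaw.
Let rr01 i : 0 <= rr i <= 1 := rseq01 hp hsum i.
Let b0 : nat -> bool := fun=> false.

Lemma Mmax_discrete n : discrete_measurable (Mmax X n).
Proof.
elim: n => [|n IH].
  have -> : Mmax X 0 = cst 0%N by apply/funext => w; rewrite /Mmax big_geq.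
  exact: discrete_measurable_cst.
have -> : Mmax X n.+1 = (fun x => maxn x.1 x.2) \o (fun w => (Mmax X n w, X n.+1 w)).
  by apply/funext => w; rewrite /= MmaxS.
by apply: discrete_measurable_comp; apply: discrete_measurable_pair => //; exact: hXmeas.
Qed.

Lemma Nrec_discrete n : discrete_measurable (Nrec X delta n).
Proof.
elim: n => [|n IH].
  have -> : Nrec X delta 0 = cst 0%N by apply/funext => w; rewrite /Nrec big_geq.
  exact: discrete_measurable_cst.
have -> : Nrec X delta n.+1 = (fun x => x.1 + (x.2.1 + delta < x.2.2))%N \o
    (fun w => (Nrec X delta n w, (Mmax X n w, X n.+1 w))).
  by apply/funext => w; rewrite /= /Nrec big_nat_recr.
apply: discrete_measurable_comp; apply: discrete_measurable_pair => //.
by apply: discrete_measurable_pair; [exact: Mmax_discrete|exact: hXmeas].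
Qed.

Lemma Usum_discrete K : discrete_measurable (fun w => Usum delta K (record X w)).
Proof. exact: (depends_below_discrete hXmeas (@Usum_depends delta K)). Qed.

(** At the lower end, (1 - y_(m1 - 1))^n <= e^(-c) because y_(m1 - 1) >= c / n; at the upper end, 1
    - (1 - y_m2)^n <= n y_m2 <= 1 / c. *)
Lemma pr_Mmax_outside (n c : nat) : (0 < c)%N -> (c <= n)%N ->
  pr [set w | ~~ (mthr p (n%:R / c%:R) <= Mmax X n w <= mthr p (c%:R * n%:R))%N] <= 2 / c%:R.
Proof.
move=> c0 cn; have n0 : (0 < n)%N by exact: leq_trans c0 cn.
have c0R : 0 < c%:R :> R by rewrite ltr0n.
have n0R : 0 < n%:R :> R by rewrite ltr0n.
have c1R : 1 <= c%:R :> R by rewrite ler1n.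
have n1R : 1 <= n%:R :> R by rewrite ler1n.
have t1 : 1 <= n%:R / c%:R :> R by rewrite ler_pdivlMr// mul1r ler_nat.
have t2 : 1 <= c%:R * n%:R :> R by rewrite mulr_ege1.
set m1 := mthr _ _; set m2 := mthr _ _.
pose A k := [set w | all (fun x => (x < k)%N) (xs X w n)].
have mA k : measurable (A k) by exact: (xs_measurable hXmeas n (fun s => all (fun x => (x < k)%N) s)).
have Y01 k : 0 <= Y k <= 1.
  by rewrite (ltW (yprev_gt0 hp hsum k)) (yprev_nincr hp hsum (leq0n k)).
have sub : [set w | ~~ (m1 <= Mmax X n w <= m2)%N] `<=` A m1 `|` ~` A m2.+1.
  move=> w /=; rewrite negb_and -!ltnNge => /orP[h|h].
    by left; rewrite /A /=; case: m1 h => // k /Mmax_ltP.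
  right; move/Mmax_ltP; lia.
have mU : measurable (A m1 `|` ~` A m2.+1) by apply: measurableU => //; exact: measurableC.
apply: le_trans (pr_le P _ mU sub) _.
  exact: (discrete_measurable_set (fun x => ~~ (m1 <= x <= m2)%N) (Mmax_discrete n)).
apply: le_trans (prU_le P (mA _) (measurableC (mA _))) _.
rewrite prC// /A !(pr_all_below hXmeas hlaw hindep).
have H1 : (1 - Y m1) ^+ n <= c%:R^-1.
  have h1 : c%:R / n%:R <= Y m1 by rewrite -invf_div; exact: mthr_ge.
  have h2 : 1 - Y m1 <= expR (- (c%:R / n%:R)).
    by apply: le_trans (expR_ge1Dx _); lra.
  apply: (@le_trans _ _ (expR (- (c%:R / n%:R)) ^+ n)).
    by rewrite lerXn2r ?nnegrE ?expR_ge0//; have := Y01 m1; lra.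
  rewrite -expRM_natl mulrN mulrC divfK ?gt_eqF// expRN lef_pV2 ?posrE ?expR_gt0//.
  by apply: le_trans (expR_ge1Dx _); lra.
have H2 : 1 - (1 - Y m2.+1) ^+ n <= c%:R^-1.
  have h1 : Y m2.+1 < (c%:R * n%:R)^-1 by exact: mthr_lt.
  have := bernoulli_ineq n (Y01 m2.+1).
  have : n%:R * Y m2.+1 <= c%:R^-1.
    rewrite -ler_pdivlMl// -invfM mulrC; exact: ltW.
  lra.
have := lerD H1 H2; lra.
Qed.

(** Markov's inequality, carried out in the finite product model. *)
Lemma pr_Usum_gap (m1 m2 : nat) (c : R) : (m1 <= m2)%N -> 0 < c ->
  pr [set w | c < (Usum delta m2 (record X w))%:R - (Usum delta m1 (record X w))%:R] <=
  (Umean rr delta m2 - Umean rr delta m1) / c.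
Proof.
move=> m12 c0.
pose S b := c < (Usum delta m2 b)%:R - (Usum delta m1 b)%:R.
have Sm : depends_below m2 S.
  move=> b b' bb'; rewrite /S; rewrite (@Usum_depends delta m2 b b')// (@Usum_depends delta m1 b b')//.
  by move=> i im1; apply: bb'; exact: leq_trans im1 m12.
rewrite -/(S _) (pr_record_law hXmeas hp hlaw hindep b0 Sm).
have -> : (Umean rr delta m2 - Umean rr delta m1) / c =
    Ex rr m2 (fun b => c^-1 * (Usum delta m2 b)%:R + ((- c^-1) * (Usum delta m1 b)%:R + 0)) b0.
  by rewrite !Ex_lin Ex_0 !Ex_Usum//; ring.
apply: Ex_le => // b; rewrite addr0 mulNr -mulrBr.
have U12 : 0 <= (Usum delta m2 b)%:R - (Usum delta m1 b)%:R :> R.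
  by rewrite subr_ge0 ler_nat Usum_homo.
rewrite /S; case: ltP => h; last by rewrite mulr_ge0// invr_ge0 ltW.
by rewrite ler_pdivlMl// mulr1 ltW.
Qed.

Definition count_below n w := Usum delta (mthr p n%:R).+1 (record X w).

(** A difference that is merely bounded in probability is enough, as it is later divided by a scale
    tending to infinity. *)
Lemma Nrec_count_below_tight (eta : R) : 0 < eta -> exists2 c0 : R, 0 < c0 &
  \forall n \near \oo,
   pr [set w | ~~ (`|(Nrec X delta n w)%:R - (count_below n w)%:R| <= c0)] <= eta.
Proof.
move=> eta0.
(* Makes the probability 2 / c of leaving the window at most eta / 2. *)
pose c := (Num.truncn (4 / eta)).+1.
have cE : 2 / c%:R <= eta / 2.
  rewrite ler_pdivrMr ?ltr0n// mulrC -ler_pdivrMr; last by lra.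
  by rewrite invf_div mulrA; have := truncnS_gt (4 / eta); rewrite -/c; lra.
have c1R : 1 <= c%:R :> R by rewrite ler1n.
(* L bounds the mean number of delta-record values in the window; Markov's inequality at c0 = 2 L /
   eta then yields eta / 2. *)
pose L : R := 1 + 2 * ln c%:R.
have L1 : 1 <= L by rewrite /L lerDl mulr_ge0// ln_ge0.
pose c0 := 2 * L / eta.
have c00 : 0 < c0 by rewrite divr_gt0//; lra.
exists c0 => //; near=> n.
have cn : (c <= n)%N by near: n; exact: nbhs_infty_ge.
have n0 : (0 < n)%N by exact: leq_trans cn.
have c0R : 0 < c%:R :> R by lra.
have n0R : 0 < n%:R :> R by rewrite ltr0n.
have n1R : 1 <= n%:R :> R by rewrite ler1n.
have t1 : 1 <= n%:R / c%:R :> R by rewrite ler_pdivlMr// mul1r ler_nat.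
have t2 : 1 <= c%:R * n%:R :> R by rewrite mulr_ege1.
have t12 : n%:R / c%:R <= n%:R :> R by rewrite ler_pdivrMr// ler_peMr// ltW.
have t23 : n%:R <= c%:R * n%:R :> R by rewrite ler_peMl// ltW.
set m1 := mthr p (n%:R / c%:R); set m2 := mthr p (c%:R * n%:R).
have m1m : (m1 <= mthr p n%:R)%N by exact: mthr_homo.
have mm2 : (mthr p n%:R <= m2)%N by exact: mthr_homo.
have m12 := leq_trans m1m mm2.
pose E1 := [set w | ~~ (m1 <= Mmax X n w <= m2)%N].
pose E2 := [set w | c0 < (Usum delta m2.+1 (record X w))%:R - (Usum delta m1.+1 (record X w))%:R].
have mE1 : measurable E1.
  exact: (discrete_measurable_set (fun x => ~~ (m1 <= x <= m2)%N) (Mmax_discrete n)).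
have mE2 : measurable E2.
  exact: (discrete_measurable_set (fun x => c0 < x.1%:R - x.2%:R)
    (discrete_measurable_pair (Usum_discrete m2.+1) (Usum_discrete m1.+1))).
apply: (@le_trans _ _ (pr (E1 `|` E2))).
  apply: pr_le.
  - exact: (discrete_measurable_set (fun x => ~~ (`|x.1%:R - x.2%:R| <= c0))
      (discrete_measurable_pair (Nrec_discrete n) (Usum_discrete (mthr p n%:R).+1))).
  - exact: measurableU.
  move=> w /= H; have [/= nE1|] := boolP (m1 <= Mmax X n w <= m2)%N; last by left.
  right; rewrite /E2 /= ltNge; apply: contra H; apply: le_trans.
  rewrite NrecE// /count_below; case/andP: nE1 => h1 h2.
  have g1 := @Usum_homo delta m1.+1 (Mmax X n w).+1 (record X w) h1.
  have g2 := @Usum_homo delta (Mmax X n w).+1 m2.+1 (record X w) h2.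
  have g3 := @Usum_homo delta m1.+1 (mthr p n%:R).+1 (record X w) m1m.
  have g4 := @Usum_homo delta (mthr p n%:R).+1 m2.+1 (record X w) mm2.
  by move: g1 g2 g3 g4; rewrite -!(ler_nat R) ler_norml; lra.
apply: le_trans (prU_le P mE1 mE2) _.
have := pr_Mmax_outside (isT : (0 < c)%N) cn; rewrite -/m1 -/m2 -/E1 => h1.
have := @pr_Usum_gap m1.+1 m2.+1 c0 m12 c00; rewrite -/E2 => h2.
have h3 : (Umean rr delta m2.+1 - Umean rr delta m1.+1) / c0 <= eta / 2.
  rewrite ler_pdivrMr// /c0 (_ : eta / 2 * (2 * L / eta) = L); last by field; rewrite gt_eqF.
  have [->|m12'] := eqVneq m1 m2; first by rewrite subrr; lra.
  have {}m12' : (m1 < m2)%N by rewrite ltn_neqAle m12'.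
  apply: le_trans (sum_qrec_itv_le delta hp hsum m12') _; rewrite /L lerD2l.
  have Yp := yprev_gt0 hp hsum.
  have y1 : ln (Y m1.+1) <= ln c%:R - ln n%:R.
    rewrite -ln_div ?posrE// ler_ln ?posrE ?divr_gt0//.
    by rewrite -invf_div; apply: ltW; exact: mthr_lt.
  have y2 : - ln (Y m2) <= ln c%:R + ln n%:R.
    rewrite -lnM ?posrE// lerNl -lnV ?posrE ?mulr_gt0// ler_ln ?posrE ?invr_gt0 ?mulr_gt0//.
    exact: mthr_ge.
  lra.
lra.
Unshelve. all: by end_near. Qed.

End record_process.

(** * Limit law of N_n for a general normalization *)

Section delta_record_limit_law.
Context (d : measure_display) (T : measurableType d) (R : realType).
Variables (P : probability T R) (X : nat -> T -> nat) (p : nat -> R).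
Hypothesis hXmeas : forall i k, measurable [set w | X i w = k].
Hypothesis hp : forall k, 0 < p k.
Hypothesis hlaw : forall i k, (1 <= i)%N -> P [set w | X i w = k] = (p k)%:E.
Hypothesis hindep : forall (n : nat) (k : nat -> nat),
     P [set w | forall i, (1 <= i <= n)%N -> X i w = k i]
       = (\prod_(1 <= i < n.+1) p (k i))%:E.
Variable delta : nat.
Local Notation pr := (pr P).
Local Notation rr := (rseq p).
Let hsum := pmf_sum hXmeas hlaw.
Let rr01 i : 0 <= rr i <= 1 := rseq01 hp hsum i.
Let b0 : nat -> bool := fun=> false.

Section clt.
Variables (B : nat -> R) (s : R).
Hypotheses (s0 : 0 < s) (Boo : B @ \oo --> +oo).
Hypothesis Vs : (fun n => Uvar rr delta (mthr p n%:R).+1 / B n ^+ 2) @ \oo --> s ^+ 2.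
Hypothesis UA : \forall n \near \oo, Umean rr delta (mthr p n%:R).+1 <= 2 * B n ^+ 2.

Let W n b := ((Usum delta (mthr p n%:R).+1 b)%:R - Umean rr delta (mthr p n%:R).+1) / B n.

Let W_depends n (a : R) : depends_below (mthr p n%:R).+1 (fun b => W n b <= a).
Proof. by move=> b b' bb'; rewrite /W (@Usum_depends delta _ b b'). Qed.

Let pr_W_le n (a e : R) : 0 < e ->
  pr [set w | W n (record X w) <= a] <= Ex rr (mthr p n%:R).+1 (fun b => ramp a e (W n b)) b0.
Proof.
move=> e0; rewrite (pr_record_law hXmeas hp hlaw hindep b0 (@W_depends n a)).
apply: Ex_le => // b; case: (leP (W n b) a) => [h|_] /=; first by rewrite ramp_le.
by have /andP[] := ramp_itv a e (W n b).
Qed.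

Let pr_W_ge n (a e : R) : 0 < e ->
  Ex rr (mthr p n%:R).+1 (fun b => ramp a e (W n b)) b0 <= pr [set w | W n (record X w) <= a + e].
Proof.
move=> e0; rewrite (pr_record_law hXmeas hp hlaw hindep b0 (@W_depends n (a + e))).
apply: Ex_le => // b; case: (leP (W n b) (a + e)) => [_|/ltW h]; last by rewrite ramp_ge.
by have /andP[] := ramp_itv a e (W n b).
Qed.

(** Off an event of small probability the normalized N_n is within e of the normalized count W. The
    distribution function of N_n at x is thus caught between those of W at x - e and x + e, these
    between ramps of width e, and the ramp means between values of [Phi] within 2 e of x. *)
Lemma Nrec_cdf_cvg (x : R) :
  (fun n => pr [set w | ((Nrec X delta n w)%:R - theta p delta (mthr p n%:R)) / B n <= x])
    @ \oo --> Phi s x.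
Proof.
apply/cvgrPdist_le => eps eps0.
pose k := normal_peak s + 1.
have k0 : 0 < k by rewrite /k; have := normal_peak_ge0 s; lra.
(* A displacement of 2 e then changes [Phi] by at most eps / 4; the 1 added in k ensures
   positivity. *)
pose e := eps / (8 * k).
have e0 : 0 < e by rewrite divr_gt0//; lra.
have ek : normal_peak s * (2 * e) <= eps / 4.
  apply: (@le_trans _ _ (k * (2 * e))); first by rewrite ler_wpM2r// /k; lra.
  by rewrite /e le_eqVlt; apply/orP; left; apply/eqP; field; rewrite gt_eqF.
have Phi_close y : `|y - x| <= 2 * e -> `|Phi s y - Phi s x| <= eps / 4.
  move=> h; apply: le_trans (Phi_lip _ _ s0) _; apply: le_trans ek.
  by rewrite ler_wpM2l ?normal_peak_ge0.
have [c1 c1P C1] := delta_record_clt_ramp rr01 b0 (x + e) s0 e0 Boo Vs UA.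
have [c2 c2P C2] := delta_record_clt_ramp rr01 b0 (x - 2 * e) s0 e0 Boo Vs UA.
have e4 : 0 < eps / 4 by lra.
have [c0 c00 tight] := Nrec_count_below_tight hXmeas hp hlaw hindep delta e4.
near=> n.
have Bn0 : 0 < B n by near: n; move/cvgryPgt: Boo; exact.
(* Absorbs both the bound c0 on N_n minus the count and the distance delta + 1 between [theta] and
   the mean count. *)
have Bnc : (c0 + delta.+1%:R) / e <= B n by near: n; move/cvgryPge: Boo; exact.
have bad : pr [set w | ~~ (`|(Nrec X delta n w)%:R - (count_below X p delta n w)%:R| <= c0)] <= eps / 4.
  by near: n.
have H1 : `|c1 - Ex rr (mthr p n%:R).+1 (fun b => ramp (x + e) e (W n b)) b0| <= eps / 4.
  by near: n; move/cvgrPdist_le: C1; exact.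
have H2 : `|c2 - Ex rr (mthr p n%:R).+1 (fun b => ramp (x - 2 * e) e (W n b)) b0| <= eps / 4.
  by near: n; move/cvgrPdist_le: C2; exact.
set Ybad := [set w | ~~ _] in bad.
set Yle := [set w | _ <= x].
have mYbad : measurable Ybad.
  exact: (discrete_measurable_set (fun x => ~~ (`|x.1%:R - x.2%:R| <= c0))
      (discrete_measurable_pair (Nrec_discrete hXmeas delta n) (Usum_discrete hXmeas delta (mthr p n%:R).+1))).
have mYle : measurable Yle.
  exact: (discrete_measurable_set (fun m : nat => (m%:R - theta p delta (mthr p n%:R)) / B n <= x)
     (Nrec_discrete hXmeas delta n)).
have mW a : measurable [set w | W n (record X w) <= a].
  exact: (depends_below_measurable hXmeas (@W_depends n a)).
have close w : ~ Ybad w ->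
    `|((Nrec X delta n w)%:R - theta p delta (mthr p n%:R)) / B n - W n (record X w)| <= e.
  move=> /negP/negbNE h; rewrite /W -mulrBl normr_div// ler_pdivrMr//.
  rewrite ler_pdivrMr// mulrC in Bnc; apply: le_trans Bnc.
  have := theta_Umean delta hp hsum (mthr p n%:R); rewrite /count_below in h.
  by move: h; rewrite !ler_norml; lra.
have up : pr Yle <= pr [set w | W n (record X w) <= x + e] + pr Ybad.
  apply: le_trans (prU_le P (mW _) mYbad); apply: pr_le => //; first exact: measurableU.
  move=> w; rewrite /Yle /= => h; have [?|/close H] := pselect (Ybad w); first by right.
  by left; rewrite /=; move: H; rewrite ler_norml; lra.
have low : pr [set w | W n (record X w) <= x - e] <= pr Yle + pr Ybad.
  apply: le_trans (prU_le P mYle mYbad); apply: pr_le => //; first exact: measurableU.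
  move=> w /= h; have [?|/close H] := pselect (Ybad w); first by right.
  by left; rewrite /Yle /=; move: H; rewrite ler_norml; lra.
have U1 := pr_W_le n (x + e) e0.
have U2 := pr_W_ge n (x - 2 * e) e0.
rewrite (_ : x - 2 * e + e = x - e) in U2; last by lra.
have P1 : Phi s (x + e + e) <= Phi s x + eps / 4.
  have : `|Phi s (x + e + e) - Phi s x| <= eps / 4 by apply: Phi_close; rewrite ger0_norm; lra.
  by rewrite ler_norml; lra.
have P2 : Phi s x - eps / 4 <= Phi s (x - 2 * e).
  have : `|Phi s (x - 2 * e) - Phi s x| <= eps / 4 by apply: Phi_close; rewrite ler0_norm; lra.
  by rewrite ler_norml; lra.
by move: H1 H2; rewrite !ler_norml; lra.
Unshelve. all: by end_near. Qed.

End clt.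

Lemma mthr_oo N : \forall n \near \oo, (N <= mthr p n%:R)%N.
Proof.
have YN := yprev_gt0 hp hsum N.
near=> n.
have nN : (yprev p N)^-1 < n%:R by near: n; exact: nbhs_infty_gtr.
have n1 : 1 <= n%:R :> R by near: n; exact: nbhs_infty_ger.
rewrite -ltnS ltnNge; apply/negP => h.
have := mthr_lt hsum n1; have := yprev_nincr hp hsum h.
have : n%:R^-1 < yprev p N by rewrite -[ltRHS]invrK ltf_pV2 ?posrE ?invr_gt0//; lra.
lra.
Unshelve. all: by end_near. Qed.

(** Common to both regimes, with b the hazards or the gap probabilities. The bound q <= b also
    controls the mean, which is at most B_n^2 + C <= 2 B_n^2 eventually. *)
Lemma Nrec_cdf_cvg_compare (b B : nat -> R) (L C : R) : 0 < L ->
  (forall j, qrec rr delta j <= b j) ->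
  (forall eps : R, 0 < eps -> exists N, forall j, (N <= j)%N ->
    `|local_var rr delta j - L * b j| <= eps * b j) ->
  B @ \oo --> +oo ->
  (\forall n \near \oo, `|B n ^+ 2 - \sum_(j < (mthr p n%:R).+1) b j| <= C) ->
  forall x,
  (fun n => pr [set w | ((Nrec X delta n w)%:R - theta p delta (mthr p n%:R)) / B n <= x])
    @ \oo --> Phi (Num.sqrt L) x.
Proof.
move=> L0 qb cmp Boo BC; apply: Nrec_cdf_cvg => //; first by rewrite sqrtr_gt0.
  rewrite sqr_sqrtr ?ltW//.
  apply: (Uvar_normalized (b := b) (C := C)) => // [i|j]; first exact: rseq_itv.
  exact: le_trans (qrec_ge0 rr01 delta j) (qb j).
near=> n.
have BCn : `|B n ^+ 2 - \sum_(j < (mthr p n%:R).+1) b j| <= C by near: n.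
have B1 : 1 <= B n by near: n; move/cvgryPge: Boo; exact.
have B2 : C <= B n by near: n; move/cvgryPge: Boo; exact.
have : Umean rr delta (mthr p n%:R).+1 <= \sum_(j < (mthr p n%:R).+1) b j by exact: ler_sum.
have : B n <= B n ^+ 2 by rewrite expr2 ler_peMl//; lra.
by move: BCn; rewrite ler_norml; lra.
Unshelve. all: by end_near. Qed.

End delta_record_limit_law.

(** * Divergence and comparison of the normalizing sums *)

Lemma sqrt_cvgy (R : realType) (u : nat -> R) : u @ \oo --> +oo ->
  (fun n => Num.sqrt (u n)) @ \oo --> +oo.
Proof.
move=> uoo; apply/cvgryPge => A; near=> n.
apply: le_trans (ler_norm A) _; rewrite -sqrtr_sqr ler_wsqrtr//.
by near: n; move/cvgryPge: uoo; exact.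
Unshelve. all: by end_near. Qed.

Lemma ln_nat_cvgy (R : realType) : (fun n => ln (n%:R : R)) @ \oo --> +oo.
Proof.
apply/cvgryPge => A; near=> n.
have h : expR A <= n%:R by near: n; exact: nbhs_infty_ger.
by rewrite -[leLHS]expRK ler_ln ?posrE ?expR_gt0// (lt_le_trans (expR_gt0 A)).
Unshelve. all: by end_near. Qed.

Section normalizations.
Variables (R : realType) (p : nat -> R) (delta : nat).
Hypotheses (hp : forall k, 0 < p k) (hsum : series p @ \oo --> (1 : R)).
Local Notation rr := (rseq p).

Lemma sum_hazard K : \sum_(j < K) hazard rr j = - ln (yprev p K).
Proof.
have Y0 := yprev_gt0 hp hsum.
elim: K => [|K IH]; first by rewrite big_ord0 /= ln1 oppr0.
by rewrite big_ord_recr IH /hazard [LHS]/= onem_rseq// ln_div ?posrE// opprB addKr.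
Qed.

(** With m = m(n), the inequalities y_m < 1 / n <= y_(m-1) place ln n between two consecutive
    partial sums of the hazards. *)
Lemma sum_hazard_mthr n : (0 < n)%N ->
  `|ln n%:R - \sum_(j < (mthr p n%:R).+1) hazard rr j| <= hazard rr (mthr p n%:R).
Proof.
move=> n0; have n1 : 1 <= n%:R :> R by rewrite ler1n.
have n0R : 0 < n%:R :> R by lra.
have Y0 := yprev_gt0 hp hsum.
have h1 : ln n%:R <= - ln (yprev p (mthr p n%:R).+1).
  rewrite lerNr -lnV ?posrE// ler_ln ?posrE ?invr_gt0//; exact: ltW (mthr_lt hsum n1).
have h2 : - ln (yprev p (mthr p n%:R)) <= ln n%:R.
  rewrite lerNl -lnV ?posrE// ler_ln ?posrE ?invr_gt0//; exact: mthr_ge.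
move: h1; rewrite -sum_hazard => h1.
move: h2; rewrite -sum_hazard => h2.
rewrite big_ord_recr /= in h1 *.
by rewrite ler_norml; lra.
Qed.

Lemma sum_eseq_gap_prob K :
  `|\sum_(k < K.+1) eseq p delta k - \sum_(j < K.+1) gap_prob rr delta j| <= delta.+1%:R.
Proof.
have r01 i : 0 <= 1 - rr i <= 1 by have := rseq01 hp hsum i; lra.
apply: shifted_sum_dist.
- by move=> i i0; rewrite /gap_prob ifT ?addnK//; lia.
- by move=> j jd; rewrite /gap_prob ltnNge jd.
- by move=> j; apply: gap_prob_itv => i; exact: rseq_itv.
rewrite /eseq prodr_ge0 => [|i _]; last by have /andP[] := r01 i.
by apply: prodr_ile1 => i; have := r01 i; lra.
Qed.

End normalizations.

(** * Finitely many delta-records when the e_k are summable *)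

Section finitely_many_delta_records.
Context (d : measure_display) (T : measurableType d) (R : realType).
Variables (P : probability T R) (X : nat -> T -> nat) (p : nat -> R) (delta : nat).
Hypothesis hXmeas : forall i k, measurable [set w | X i w = k].
Hypothesis hp : forall k, 0 < p k.
Hypothesis hlaw : forall i k, (1 <= i)%N -> P [set w | X i w = k] = (p k)%:E.
Hypothesis hindep : forall (n : nat) (k : nat -> nat),
     P [set w | forall i, (1 <= i <= n)%N -> X i w = k i]
       = (\prod_(1 <= i < n.+1) p (k i))%:E.
Local Notation rr := (rseq p).
Let hsum := pmf_sum hXmeas hlaw.
Let rr01 i : 0 <= rr i <= 1 := rseq01 hp hsum i.
Let F j := [set w | drec delta (record X w) j].

Let drec_depends j : depends_below j.+1 (fun b => drec delta b j).
Proof.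
move=> b b' bb'; rewrite /drec bb'//; congr [&& _, _ & _].
apply: eq_in_all => i; rewrite mem_index_iota => /andP[_ ij].
by rewrite bb'//; exact: leqW.
Qed.

Let mF j : measurable (F j).
Proof. exact: (depends_below_measurable hXmeas (@drec_depends j)). Qed.

Lemma P_drec j : P (F j) = (qrec rr delta j)%:E.
Proof.
rewrite (prE P (mF j)); congr EFin.
rewrite (pr_record_law hXmeas hp hlaw hindep (fun=> false) (@drec_depends j)).
by rewrite Ex_drec.
Qed.

(** Almost surely no j from some N on is a delta-record value; then N_n, which is nondecreasing,
    stays below N and converges. *)
Lemma ae_cvg_Nrec : cvg (series (eseq p delta) @ \oo) ->
  {ae P, forall w, cvg ((fun n => ((Nrec X delta n w)%:R : R)) @ \oo)}.
Proof.
move=> he.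
have e_ge0 k : 0 <= eseq p delta k.
  by apply: prodr_ge0 => i _; have := rr01 i; lra.
have Foo : (\sum_(n <oo) P (F n) < +oo)%E.
  apply: (@le_lt_trans _ _ (limn (series (eseq p delta)) + delta.+1%:R)%:E); last exact: ltry.
  apply: lime_le; first by apply: is_cvg_nneseries => n _ _; exact: measure_ge0.
  near=> n.
  rewrite (eq_bigr (fun j => (qrec rr delta j)%:E)) => [|j _]; last exact: P_drec.
  rewrite sumEFin lee_fin.
  have n0 : (0 < n)%N by near: n; exact: nbhs_infty_ge.
  have := sum_eseq_gap_prob delta hp hsum n.-1; rewrite prednK//.
  have : series (eseq p delta) n <= limn (series (eseq p delta)).
    apply: nondecreasing_cvgn_le => //; apply/nondecreasing_seqP => k.
    by rewrite /series /= big_nat_recr//= lerDl.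
  have : \sum_(0 <= j < n) qrec rr delta j <= \sum_(j < n) gap_prob rr delta j.
    rewrite big_mkord; apply: ler_sum => j _; apply: qrec_le_gap_prob => i; exact: rseq_itv.
  by rewrite /series /= !big_mkord ler_norml; lra.
have P0 := lim_sup_set_cvg0 mF Foo.
exists (lim_sup_set F); split => //.
  by apply: bigcap_measurable => // n _; apply: bigcup_measurable => j _; exact: mF.
move=> w ncvg N _.
apply: contrapT => nF; apply: ncvg.
have nodrec j : (N <= j)%N -> drec delta (record X w) j = false.
  by move=> Nj; apply/negP => dj; apply: nF; exists j.
apply: nondecreasing_is_cvgn.
  apply/nondecreasing_seqP => n; rewrite ler_nat /Nrec [leqRHS]big_nat_recr//=; exact: leq_addr.
exists N%:R => _ [n _ <-]; rewrite ler_nat.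
case: n => [|n]; first by rewrite /Nrec big_geq.
rewrite NrecE// /Usum.
set K := (Mmax X n.+1 w).+1.
apply: (@leq_trans (\sum_(j < K) (j < N))%N).
  by apply: leq_sum => j _; case: ltnP => [_|/nodrec ->//]; exact: leq_b1.
rewrite -big_mkcond /= sum1_card cardE -(size_map val) -[leqRHS](size_iota 0).
apply: uniq_leq_size; first by rewrite map_inj_uniq ?enum_uniq//; exact: val_inj.
by move=> k /mapP[j]; rewrite mem_enum => jN ->; rewrite mem_iota add0n; exact: jN.
Unshelve. all: by end_near. Qed.

End finitely_many_delta_records.

Theorem theorem4p1 (d : measure_display) (T : measurableType d) (R : realType)
  (P : probability T R) (X : nat -> T -> nat) (p : nat -> R) (delta : nat) (r : R)
  (* X_1, X_2, ... are measurable Z_+-valued random variables *)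
  (hXmeas : forall i k, measurable [set w | X i w = k])
  (* common law: P[X_i = k] = p_k > 0 *)
  (hp : forall k, 0 < p k)
  (hlaw : forall i k, (1 <= i)%N -> P [set w | X i w = k] = (p k)%:E)
  (* independence: the joint law of X_1..X_n is the product law, for every n *)
  (hindep : forall (n : nat) (k : nat -> nat),
     P [set w | forall i, (1 <= i <= n)%N -> X i w = k i]
       = (\prod_(1 <= i < n.+1) p (k i))%:E)
  (hdelta : (0 < delta)%N)
  (hr01 : 0 <= r <= 1)
  (hr : rseq p @ \oo --> r) :
  (r < 1 ->
     cvg_dist_normal P
       (fun n w => (Num.sqrt (ln n%:R))^-1
                   * ((Nrec X delta n w)%:R - theta p delta (mthr p (n%:R)%R)))
       (sigma2 delta r))
  /\
  (r = 1 ->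
     (series (eseq p delta) @ \oo --> +oo ->
        cvg_dist_normal P
          (fun n w => ((Nrec X delta n w)%:R - theta p delta (mthr p (n%:R)%R))
                      / Num.sqrt (\sum_(k < (mthr p (n%:R)%R).+1) eseq p delta k))
          1)
     /\
     (cvg (series (eseq p delta) @ \oo) ->
        {ae P, forall w, cvg ((fun n => ((Nrec X delta n w)%:R : R)) @ \oo)})).
Proof.
have hsum := pmf_sum hXmeas hlaw.
have rr01 i : 0 < rseq p i < 1 := rseq_itv hp hsum i.
have key := Nrec_cdf_cvg_compare hXmeas hp hlaw hindep (delta := delta).
split => [r1 x|r1].
  have r01 : 0 <= r < 1 by case/andP: hr01 => -> _.
  have hC : \forall n \near \oo,
      `|Num.sqrt (ln n%:R) ^+ 2 - \sum_(j < (mthr p n%:R).+1) hazard (rseq p) j| <= 2 / (1 - r).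
    (* Half of the distance from r to 1 is kept: 1 - r_m >= (1 - r) / 2, so the hazard at m = m(n),
       at most r_m / (1 - r_m), is bounded by 2 / (1 - r). *)
    have hr2 : \forall j \near \oo, rseq p j <= (1 + r) / 2.
      by move/cvgrPdist_lt: hr => /(_ ((1 - r) / 2) ltac:(lra)); apply: filterS => j /=;
        rewrite ltr_norml; lra.
    case: hr2 => N _ hN; near=> n.
    have n0 : (0 < n)%N by near: n; exact: nbhs_infty_ge.
    have Nm : (N <= mthr p n%:R)%N by near: n; exact: (mthr_oo hXmeas hp hlaw).
    rewrite sqr_sqrtr; last by rewrite ln_ge0// ler1n.
    apply: le_trans (sum_hazard_mthr hp hsum n0) _; move: (mthr p _) Nm => m /hN /= hm.
    rewrite ler_pdivlMr; last by lra.
    have := hazard_le rr01 m; have := hazard_gt0 rr01 m; have := rr01 m.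
    move: (hazard _ _) (rseq p m) hm => h u; nra.
  have := key _ _ _ _ (sigma2_gt0 delta r01) _ (local_var_hazard delta rr01 hr r01)
    (sqrt_cvgy (@ln_nat_cvgy R)) hC x.
  rewrite /pr /Phi; under eq_fun do under eq_set do rewrite mulrC.
  by apply => j; exact: le_trans (qrec_le (fun i => rseq01 hp hsum i) delta j) (le_hazard rr01 j).
split => [eoo x|]; last exact: ae_cvg_Nrec.
have Soo : (fun n => \sum_(k < (mthr p n%:R).+1) eseq p delta k) @ \oo --> +oo.
  apply/cvgryPge => A; move/cvgryPge: eoo => /(_ A) [N _ HN].
  near=> n.
  have Nm : (N <= mthr p n%:R)%N by near: n; exact: (mthr_oo hXmeas hp hlaw).
  by have := HN _ (leqW Nm); rewrite /series /= big_mkord.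
have hC : \forall n \near \oo,
    `|Num.sqrt (\sum_(k < (mthr p n%:R).+1) eseq p delta k) ^+ 2
      - \sum_(j < (mthr p n%:R).+1) gap_prob (rseq p) delta j| <= delta.+1%:R.
  near=> n; rewrite sqr_sqrtr; first exact: sum_eseq_gap_prob.
  apply: sumr_ge0 => k _; apply: prodr_ge0 => i _; have := rr01 i; lra.
exact: (key _ _ _ _ ltr01 (qrec_le_gap_prob delta rr01) (local_var_gap rr01 hr hdelta r1)
  (sqrt_cvgy Soo) hC x).
Unshelve. all: by end_near. Qed.
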